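(* For every $n\ge3$, the staircase partial order relation $\preceq$ endows the set $\mathcal{E}_n$ with a structure of distributive lattice.
   Context: A plane branch is a reduced irreducible germ $(C,O)$ of complex analytic curve on a germ $(\mathcal{S},O)$ of smooth complex analytic surface. A model over $(\mathcal{S},O)$ is a composition of finitely many blow-ups of points above $O$. An infinitely near point of $O$ is a point lying over $O$ on some model, two such points being identified when the bimeromorphic map between the models is an isomorphism near them. $E(P)$ denotes the exceptional curve created by blowing up $P$, and also its strict transforms. $Q$ is proximate to $P$ if $Q\in E(P)$. A point $\neq O$ is free if it is proximate to exactly one point, and satellite if it is proximate to two. The minimal embedded resolution of $(C,O)$ is obtained by repeatedly blowing up the unique point where the total transform of $C$ is not a normal crossing. Let $P_0=O,P_1,\dots,P_{n-1}$ be the points blown up, in order; $n$ is the blow-up complexity of $C$ ($n=0$ if $C$ is smooth, $n\ge3$ otherwise). Enriques diagram of $C$ (for $n\ge3$): the path graph with vertices $v_0,\dots,v_{n-1}$ (with $v_i$ corresponding to $P_i$) and edges $e_i=[v_{i-1}v_i]$, $1\le i\le n-1$, where each edge is decorated as curved or straight and each vertex as breaking or neutral, as follows. A straight path is a path of straight edges all of whose interior vertices are neutral; it is maximal if adding an adjacent edge never gives a straight path. (1) $e_i$ is curved iff $P_i$ is free. (2) If $P_{i+1},\dots,P_k$ are all the points of the sequence proximate to $P_i$ and $k\ge i+2$, then $[v_{i+1}v_k]$ is a maximal straight path, and if moreover $e_{i+1}$ is straight then $v_{i+1}$ is a breaking vertex. All other vertices are neutral. $\mathcal{E}_n$ is the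 set of isomorphism classes of Enriques diagrams of plane branches of blow-up complexity $n$. Always $e_1$ is curved, $e_{n-1}$ is straight and $v_0,v_1,v_{n-1}$ are neutral; a decoration with these properties is an Enriques diagram of complexity $n$ iff both edges adjacent to every breaking vertex are straight. Let $S_n=\{v_2,\dots,v_{n-2},e_2,\dots,e_{n-2}\}$ (a set of symbols). The code $\chi(\epsilon)\subseteq S_n$ of $\epsilon\in\mathcal{E}_n$ is the set of symbols in $S_n$ of the straight edges and of the breaking vertices of $\epsilon$. The staircase partial order on $\mathcal{E}_n$ is: $\epsilon\preceq\epsilon'$ iff $\chi(\epsilon)\subseteq\chi(\epsilon')$. A lattice is a poset in which any two elements have an infimum and a supremum; it is distributive if each of these two operations is distributive with respect to the other. *)

(* Defs.v *)
From mathcomp Require Import all_boot all_order all_algebra.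
From mathcomp Require Import boolp reals.
From mathcomp Require Import complex.

Set Implicit Arguments.
Unset Strict Implicit.
Unset Printing Implicit Defensive.

Import Order.TTheory GRing.Theory Num.Theory.
Local Open Scope ring_scope.

Section PlaneBranches.

Variable R : realType.
Local Notation C := R[i].

(* Local coordinates identify the germ of surface with (C^2, 0) and its ring of
   germs of holomorphic functions with C{x,y}; [f i j] is the coefficient of
   x^i y^j. *)
Definition series := nat -> nat -> C.

(* Absolute convergence on the polydisc |x|, |y| <= r. In the order of R[i],
   [0 < r] forces r to be real, and so does [_ <= M] for M. *)
Definition convergent (f : series) : Prop :=
  exists r M : C, 0 < r /\
    forall N : nat, \sum_(i < N) \sum_(j < N) `|f i j| * r ^+ (i + j) <= M.

Definition szero : series := fun _ _ => 0.
Definition sone : series := fun i j => ((i == 0%N) && (j == 0%N))%:R.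
Definition sX : series := fun i j => ((i == 1%N) && (j == 0%N))%:R.
Definition sY : series := fun i j => ((i == 0%N) && (j == 1%N))%:R.
Definition smul (f g : series) : series := fun i j =>
  \sum_(k < i.+1) \sum_(l < j.+1) f k l * g (i - k)%N (j - l)%N.
Definition spow (f : series) (m : nat) : series := iter m (smul f) sone.

Definition sdivides (g f : series) : Prop :=
  exists h, convergent h /\ f = smul g h.
Definition sunit (f : series) : Prop := convergent f /\ sdivides f sone.

(* A reduced irreducible germ of curve, given by a local equation: an
   irreducible element of C{x,y}. *)
Definition plane_branch (f : series) : Prop :=
  [/\ convergent f, f <> szero, ~ sunit f &
      forall g h, convergent g -> convergent h -> f = smul g h ->
        sunit g \/ sunit h].

(* P^1(C): [Some c] is the direction [1 : c], [None] is [0 : 1]. *)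
Definition direction := option C.

(* The points created by one blow-up form the projective line of directions at
   its centre, so an infinitely near point of O is the sequence of directions
   leading to it; [::] is O itself. At each of these points we use the local
   coordinates (x, y) in which the last blow-up reads
     (x, y) |-> (x, x (y + c))   in the direction [1 : c],
     (x, y) |-> (x y, y)         in the direction [0 : 1]. *)
Definition point := seq direction.

(* sum a_ij x^(i+j) (y+c)^j  and  sum a_ij x^i y^(i+j), respectively. *)
Definition pullback (d : direction) (a : series) : series :=
  match d with
  | Some c => fun k l =>
      \sum_(j < k.+1) a (k - j)%N j * (c ^+ (j - l) *+ 'C(j, l))
  | None => fun k l => if (k <= l)%N then a k (l - k)%N else 0
  end.

(* Local equation, at the point of direction d, of the curve created by the
   blow-up. *)
Definition exceptional_eq (d : direction) : series :=
  if d is Some _ then sX else sY.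

Definition total_transform (f : series) (q : point) : series :=
  foldl (fun g d => pullback d g) f q.

(* g' is a local equation of the strict transform of g = 0. *)
Definition is_strict (d : direction) (g g' : series) : Prop :=
  exists m, [/\ convergent g',
    pullback d g = smul (spow (exceptional_eq d) m) g' &
    ~ sdivides (exceptional_eq d) g'].

Fixpoint is_strict_along (r : point) (g g' : series) : Prop :=
  if r is d :: r' then exists h, is_strict d g h /\ is_strict_along r' h g'
  else g' = g.

(* q lies on (the strict transform of) the curve E(p). *)
Definition proximate (q p : point) : Prop :=
  exists d r g, [/\ q = p ++ d :: r,
    is_strict_along r (exceptional_eq d) g & g 0%N 0%N = 0].

Definition is_free (q : point) : Prop :=
  q <> [::] /\ exists! p, proximate q p.

Definition local_coordinates (u v : series) : Prop :=
  [/\ convergent u, convergent v, u 0%N 0%N = 0, v 0%N 0%N = 0 &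
      u 1%N 0%N * v 0%N 1%N - u 0%N 1%N * v 1%N 0%N != 0].

Definition normal_crossing (f : series) : Prop :=
  exists u v w a b, [/\ local_coordinates u v, sunit w &
    f = smul w (smul (spow u a) (spow v b))].

(* q is a point lying over O of the model obtained by blowing up the points
   of K. *)
Definition on_model (K : seq point) (q : point) : Prop :=
  q \notin K /\ forall k, (k < size q)%N -> take k q \in K.

Definition is_minimal_embedded_resolution (f : series) (P : seq point) : Prop :=
  (forall i, (i < size P)%N ->
     unique (fun q => on_model (take i P) q /\
                      ~ normal_crossing (total_transform f q))
            (nth [::] P i))
  /\ (forall q, on_model P q -> normal_crossing (total_transform f q)).

End PlaneBranches.

(* Decorations of the path v_0, ..., v_{n-1}: the set of straight edges, where
   e : 'I_n.-1 stands for e_{e+1} = [v_e v_{e+1}], and the set of breaking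
   vertices. In an Enriques diagram e_1 is curved and e_{n-1} is straight, so
   reversing the path is never an isomorphism: isomorphic diagrams are equal
   decorations. *)
Definition decoration (n : nat) := ({set 'I_n.-1} * {set 'I_n})%type.

Section Decorations.

Variables (n : nat) (eps : decoration n).

Definition straight_edge (i : nat) : bool :=
  [exists e in eps.1, e.+1 == i :> nat].

Definition breaking_vertex (i : nat) : bool :=
  [exists v in eps.2, v == i :> nat].

Definition straight_path (a b : nat) : Prop :=
  [/\ (a < b < n)%N,
      forall j, (a < j <= b)%N -> straight_edge j &
      forall j, (a < j < b)%N -> ~~ breaking_vertex j].

Definition maximal_straight_path (a b : nat) : Prop :=
  [/\ straight_path a b,
      forall a', a = a'.+1 -> ~ straight_path a' b &
      ~ straight_path a b.+1].

End Decorations.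

(* P_{i+1}, ..., P_k are all the points of the sequence proximate to P_i, and
   k >= i + 2. *)
Definition long_proximity (R : realType) (P : seq (point R)) (i k : nat) :=
  (i.+2 <= k < size P)%N /\
  forall j, (j < size P)%N ->
    (proximate (nth [::] P j) (nth [::] P i) <-> (i < j <= k)%N).

Definition is_enriques_diagram (R : realType) (P : seq (point R)) (n : nat)
    (eps : decoration n) : Prop :=
  [/\ forall i, (1 <= i < n)%N ->
        (~~ straight_edge eps i <-> is_free (nth [::] P i)),
      forall i k, long_proximity P i k ->
        maximal_straight_path eps i.+1 k /\
        (straight_edge eps i.+1 -> breaking_vertex eps i.+1) &
      forall j, breaking_vertex eps j ->
        exists i k, [/\ j = i.+1, long_proximity P i k &
                        straight_edge eps i.+1]].

Definition enriques_diagrams (R : realType) (n : nat) : Type :=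
  {eps : decoration n | `[< exists (f : series R) (P : seq (point R)),
     [/\ plane_branch f, is_minimal_embedded_resolution f P, size P = n &
         is_enriques_diagram P eps] >]}.

(* Symbols: [inl e] is the edge e_{e+1}, [inr v] is the vertex v_v. *)
Definition symbols (n : nat) : {set 'I_n.-1 + 'I_n} :=
  [set s : 'I_n.-1 + 'I_n | match s with
           | inl e => (2 <= e.+1 <= n - 2)%N
           | inr v => (2 <= v <= n - 2)%N
           end].

Definition code (n : nat) (eps : decoration n) : {set 'I_n.-1 + 'I_n} :=
  [set s : 'I_n.-1 + 'I_n in symbols n | match s with
                        | inl e => e \in eps.1
                        | inr v => v \in eps.2
                        end].

Definition staircase (R : realType) (n : nat) (x y : enriques_diagrams R n) :
    bool :=
  code (val x) \subset code (val y).

(* Main.v *)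
Require Import Defs.
From HB Require Import structures.
From mathcomp Require Import all_boot all_order all_algebra.
From mathcomp Require Import boolp reals complex.
From mathcomp Require Import ring zify.

(* A decoration is the Enriques diagram of a plane branch iff [e_1] is curved,
   [e_(n-1)] is straight and both edges at every breaking vertex are straight.
   These conditions are stable under intersection and union of the sets of
   straight edges and of breaking vertices, hence a sublattice of a power set.

   Necessity: the strict transforms of an irreducible germ stay irreducible and
   have a single tangent; if the last point blown up were free, a transversal
   smooth strict transform after the blow-up would descend to a normal crossing
   before it. Sufficiency: the decoration dictates the directions of the
   infinitely near points, and the line [y = x] at the last of them is blown
   down step by step. Both directions replace a germ by a Weierstrass polynomial
   [H(x, y)] of degree [k], whose blow-down [x^k H(x, y / x - c)] is again a
   convergent series; so the analytic input is the Weierstrass division theorem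
   for convergent series. *)

Set Implicit Arguments.
Unset Strict Implicit.
Unset Printing Implicit Defensive.

Import Order.TTheory GRing.Theory Num.Theory.
Local Open Scope ring_scope.

(** * Formal power series *)

(** Blowing down has to clear powers of 1/x, so it needs a bound on the y-degree. A Weierstrass
    polynomial has one, and it equals y^k on x = 0, which makes every other direction miss its
    strict transform. The same polynomials replace Puiseux series in the proof that an irreducible
    germ has a single tangent: a factor of the strict transform is blown down and the germ is
    divided by the result. Blowing down in an arbitrary direction requires preparation in either
    variable, hence the invariant [off_axes]. In the chosen charts every exceptional curve through
    an infinitely near point is a coordinate axis. A total transform is therefore carried as x^a y^b
    times a unit times an irreducible series, where only the positivity of a and b matters, and
    proximity becomes a condition on the sequence of directions alone. The line y = x is taken at
    the last point because it is transversal to both axes: there it is a third branch at a crossing,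
    and one more blow-up separates the three. *)

Definition fps (A : Type) : Type := nat -> A.

HB.instance Definition _ A := gen_eqMixin (fps A).
HB.instance Definition _ A := gen_choiceMixin (fps A).

Section FpsZmodule.
Variable A : zmodType.
Implicit Types f g h : fps A.

Let fps_add f g : fps A := fun n => f n + g n.
Let fps_opp f : fps A := fun n => - f n.
Let fps_zero : fps A := fun=> 0.

Let fps_addA : associative fps_add.
Proof. by move=> f g h; apply/funext => n; exact: addrA. Qed.
Let fps_addC : commutative fps_add.
Proof. by move=> f g; apply/funext => n; exact: addrC. Qed.
Let fps_add0 : left_id fps_zero fps_add.
Proof. by move=> f; apply/funext => n; exact: add0r. Qed.
Let fps_addN : left_inverse fps_zero fps_opp fps_add.
Proof. by move=> f; apply/funext => n; exact: addNr. Qed.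

HB.instance Definition _ :=
  GRing.isZmodule.Build (fps A) fps_addA fps_addC fps_add0 fps_addN.

Lemma fpsD f g n : (f + g) n = f n + g n. Proof. by []. Qed.
Lemma fpsN f n : (- f) n = - f n. Proof. by []. Qed.
Lemma fps0 n : (0 : fps A) n = 0. Proof. by []. Qed.

Lemma fps_sum (I : Type) (r : seq I) (P : pred I) (F : I -> fps A) n :
  (\sum_(i <- r | P i) F i) n = \sum_(i <- r | P i) F i n.
Proof. by elim/big_rec2: _ => // i x y _ <-. Qed.

End FpsZmodule.

Section FpsRing.
Variable A : comNzRingType.
Implicit Types f g h : fps A.

Let fps_mul f g : fps A := fun n => \sum_(i < n.+1) f i * g (n - i)%N.
Let fps_one : fps A := fun n => (n == 0%N)%:R.

(* Up to order [N], the Cauchy product is the product of the truncated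
   polynomials; the ring axioms are transferred along this. *)
Let fps_mulE f g N n : (n < N)%N ->
  fps_mul f g n = ((\poly_(i < N) f i) * (\poly_(i < N) g i))`_n.
Proof.
move=> nN; rewrite coefM; apply: eq_bigr => i _.
rewrite !coef_poly (leq_ltn_trans (leq_subr _ _) nN).
by rewrite (leq_trans (ltn_ord i)).
Qed.

Let fps_mulC : commutative fps_mul.
Proof.
by move=> f g; apply/funext => n; rewrite !(fps_mulE _ _ (ltnSn n)) mulrC.
Qed.

Let fps_mulA : associative fps_mul.
Proof.
move=> f g h; apply/funext => n; pose N := n.+1.
pose t u := \poly_(i < N) (u i : A).
have tM u v m : (m < N)%N -> (t (fps_mul u v))`_m = (t u * t v)`_m.
  by move=> mN; rewrite coef_poly mN (fps_mulE _ _ mN).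
rewrite !(fps_mulE _ _ (ltnSn n)) -/(t f) -/(t h) -/(t (fps_mul f g)).
rewrite -/(t (fps_mul g h)).
transitivity (t f * (t g * t h))`_n; last rewrite mulrA.
  rewrite !coefM; apply: eq_bigr => i _; congr (_ * _).
  by rewrite tM // ltnS leq_subr.
by rewrite [in LHS]coefM [RHS]coefM; apply: eq_bigr => i _; rewrite tM.
Qed.

Let fps_mul1 : left_id fps_one fps_mul.
Proof.
move=> f; apply/funext => n; rewrite /fps_mul big_ord_recl /= subn0 mul1r.
by rewrite big1 ?addr0 // => i _; rewrite /fps_one mul0r.
Qed.

Let fps_mulDl : left_distributive fps_mul +%R.
Proof.
move=> f g h; apply/funext => n; rewrite fpsD -big_split /=.
by apply: eq_bigr => i _; rewrite fpsD mulrDl.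
Qed.

Let fps_oner_neq0 : fps_one != 0.
Proof.
by apply/eqP => /(congr1 (fun f : fps A => f 0%N))/eqP; rewrite oner_eq0.
Qed.

HB.instance Definition _ := GRing.Zmodule_isComNzRing.Build (fps A)
  fps_mulA fps_mulC fps_mul1 fps_mulDl fps_oner_neq0.

Lemma fpsM f g n : (f * g) n = \sum_(i < n.+1) f i * g (n - i)%N.
Proof. by []. Qed.

Lemma fps1 n : (1 : fps A) n = (n == 0%N)%:R. Proof. by []. Qed.

Lemma fpsM0 f g : (f * g) 0%N = f 0%N * g 0%N.
Proof. by rewrite fpsM big_ord1 subnn. Qed.

Lemma fpsX0 f n : (f ^+ n) 0%N = f 0%N ^+ n.
Proof. by elim: n => // n IH; rewrite !exprS fpsM0 IH. Qed.

Definition cst (a : A) : fps A := fun n => if n == 0%N then a else 0.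
Definition var : fps A := fun n => (n == 1%N)%:R.

Lemma cstM a f n : (cst a * f) n = a * f n.
Proof.
rewrite fpsM big_ord_recl /= subn0 big1 ?addr0 // => i _.
by rewrite /cst /= mul0r.
Qed.

Lemma varM f n : (var * f) n = if n is m.+1 then f m else 0.
Proof.
rewrite fpsM; case: n => [|n]; first by rewrite big_ord1 mul0r.
rewrite !big_ord_recl /= /bump /= mul0r add0r mul1r subSS subn0 big1 ?addr0 //.
by move=> i _; rewrite mul0r.
Qed.

Lemma varXM k f n : (var ^+ k * f) n = if (k <= n)%N then f (n - k)%N else 0.
Proof.
elim: k n => [|k IH] n; first by rewrite mul1r subn0.
by rewrite exprS -mulrA varM; case: n => // n; rewrite IH.
Qed.

Lemma varX k n : (var ^+ k) n = (n == k)%:R.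
Proof.
rewrite -[var ^+ k]mulr1 varXM fps1 subn_eq0 eqn_leq.
by case: (leqP k n) => h; rewrite ?andbT ?andbF.
Qed.

Lemma cst_is_zmod_morphism : zmod_morphism cst.
Proof.
by move=> a b; apply/funext => -[|n]; rewrite fpsD fpsN /cst //= subr0.
Qed.
Lemma cst_is_monoid_morphism : monoid_morphism cst.
Proof.
split=> [|a b]; apply/funext => n; first by rewrite fps1 /cst; case: n.
by rewrite cstM /cst; case: n => //= n; rewrite mulr0.
Qed.
HB.instance Definition _ := GRing.isZmodMorphism.Build A (fps A) cst
  cst_is_zmod_morphism.
HB.instance Definition _ := GRing.isMonoidMorphism.Build A (fps A) cst
  cst_is_monoid_morphism.

Definition of_poly (p : {poly A}) : fps A := fun n => p`_n.

Lemma of_poly_is_zmod_morphism : zmod_morphism of_poly.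
Proof. by move=> p q; apply/funext => n; rewrite /of_poly coefB. Qed.
Lemma of_poly_is_monoid_morphism : monoid_morphism of_poly.
Proof.
split=> [|p q]; apply/funext => n; first by rewrite /of_poly coef1.
by rewrite /of_poly coefM.
Qed.
HB.instance Definition _ := GRing.isZmodMorphism.Build {poly A} (fps A) of_poly
  of_poly_is_zmod_morphism.
HB.instance Definition _ := GRing.isMonoidMorphism.Build {poly A} (fps A)
  of_poly of_poly_is_monoid_morphism.

Lemma fps_shift f k : (forall n, (n < k)%N -> f n = 0) ->
  f = var ^+ k * (fun n => f (n + k)%N : A).
Proof.
move=> f0; apply/funext => n; rewrite varXM.
by case: leqP => [kn|/f0//]; rewrite subnK.
Qed.

Lemma varXI k : injective ( *%R (var ^+ k)).
Proof.
move=> f g /(congr1 (fun u : fps A => fun n => u (n + k)%N)) fg.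
apply/funext => n; have := congr1 (fun u => u n) fg.
by rewrite /= !varXM leq_addl addnK.
Qed.

Lemma fps_val f : f <> 0 -> exists k (g : fps A), f = var ^+ k * g /\ g 0%N <> 0.
Proof.
move=> fn0; have /existsNP[n /eqP fn] : ~ forall n, f n = 0.
  by move=> f0; apply: fn0; apply/funext.
have exn : exists n, f n != 0 by exists n.
case: (ex_minnP exn) => k fk kmin; exists k, (fun n => f (n + k)%N); split.
  apply: fps_shift => i ik; apply/eqP; apply: contraTT ik => /kmin.
  by rewrite -leqNgt.
exact/eqP.
Qed.

(** Over [A := fps C] the condition [f 0 <> 0] says that x does not divide f, so this is the
    uniqueness of the multiplicity along x = 0 and of the residual factor. *)
Lemma varX_row0 k l f g : f 0%N <> 0 -> g 0%N <> 0 ->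
  var ^+ k * f = var ^+ l * g -> k = l /\ f = g.
Proof.
wlog kl : k l f g / (k <= l)%N.
  move=> H f0 g0 fg; case: (leqP k l) => kl; first exact: H.
  by case: (H l k g f (ltnW kl) g0 f0 (esym fg)).
move=> f0 g0; rewrite -(subnKC kl) exprD -mulrA => /varXI fg.
case E: (l - k)%N fg => [|d] fg.
  by split; [rewrite addn0 | rewrite fg mul1r].
by case: f0; rewrite fg varXM.
Qed.

(** The lowest coefficients multiply. Integrality is a proposition about [A], so that the lemma can
    be applied twice to reach two variables. *)
Lemma fps_domain : (forall a b : A, a * b = 0 -> a = 0 \/ b = 0) ->
  forall f g, f * g = 0 -> f = 0 \/ g = 0.
Proof.
move=> dom f g fg0; have [->|/eqP f0] := eqVneq f 0; first by left.
have [->|/eqP g0] := eqVneq g 0; first by right.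
have [k [f' [fE f'0]]] := fps_val f0; have [l [g' [gE g'0]]] := fps_val g0.
move: fg0; rewrite fE gE mulrACA -exprD => fg0.
have : f' * g' = 0.
  by apply: (@varXI (k + l)); rewrite fg0 mulr0.
move/(congr1 (fun u : fps A => u 0%N)); rewrite fpsM0 => /dom[]//.
Qed.

End FpsRing.

Arguments var {A}.

(** * Weighted norms *)

Section WeightedNorms.
Variable C : numFieldType.

(** The antidiagonals of index below N fill only the triangle a + b < N of the square. This serves
    the Cauchy product and, in [convergent_chart], the grouping of terms by total degree. *)
Lemma triangle_sum_le (u : nat -> nat -> C) N : (forall i j, 0 <= u i j) ->
  \sum_(i < N) \sum_(k < i.+1) u k (i - k)%N <= \sum_(i < N) \sum_(j < N) u i j.
Proof.
move=> u0.
have -> : \sum_(i < N) \sum_(k < i.+1) u k (i - k)%N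
        = \sum_(k < N) \sum_(i < N | (k <= i)%N) u k (i - k)%N.
  rewrite (exchange_big_dep xpredT) //=; apply: eq_bigr => i _.
  by rewrite (@big_ord_widen _ _ _ _ N (fun k => u k (i - k)%N) (ltn_ord i)).
apply: ler_sum => k _.
have -> : \sum_(i < N | (k <= i)%N) u k (i - k)%N
        = \sum_(j < N - k) u k j.
  rewrite -(big_geq_mkord k N xpredT (fun i => u k (i - k)%N)).
  rewrite -[X in \sum_(X <= _ < _) _]add0n big_addn big_mkord.
  by under eq_bigr do rewrite addnK.
rewrite (@big_ord_widen _ _ _ _ N (u k) (leq_subr k N)) [leRHS](bigID (fun j : 'I_N => j < N - k)%N) /=.
by rewrite lerDl sumr_ge0.
Qed.

Definition seminorm (A : comNzRingType) (nu : A -> C) :=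
  [/\ nu 0 = 0, forall a, 0 <= nu a, forall a b, nu (a + b) <= nu a + nu b
    & forall a b, nu (a * b) <= nu a * nu b].

(** Truncation at order N replaces infinite sums: convergence becomes a bound uniform in N. As [nu]
    is an arbitrary seminorm, the construction iterates to two variables. *)
Definition fps_norm (A : comNzRingType) (nu : A -> C) (r : C) N (f : fps A) : C :=
  \sum_(i < N) nu (f i) * r ^+ i.

Lemma seminorm_normr : seminorm (Num.norm : C -> C).
Proof.
split=> [|a|a b|a b]; rewrite ?normr0 ?normr_ge0 ?normrM //.
exact: ler_normD.
Qed.

Section Seminorm.
Variables (A : comNzRingType) (nu : A -> C) (nuP : seminorm nu).

Let nu0 : nu 0 = 0. Proof. by case: nuP. Qed.
Let nu_ge0 a : 0 <= nu a. Proof. by case: nuP. Qed.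
Let nuD a b : nu (a + b) <= nu a + nu b. Proof. by case: nuP. Qed.
Let nuM a b : nu (a * b) <= nu a * nu b. Proof. by case: nuP. Qed.

Lemma seminorm_sum (I : Type) (s : seq I) (P : pred I) (F : I -> A) :
  nu (\sum_(i <- s | P i) F i) <= \sum_(i <- s | P i) nu (F i).
Proof.
elim/big_rec2: _ => [|i x y _ IH]; first by rewrite nu0.
by apply: le_trans (nuD _ _) _; rewrite lerD2l.
Qed.

Lemma seminormX a n : nu 1 <= 1 -> nu (a ^+ n) <= nu a ^+ n.
Proof.
move=> n1; elim: n => [|n IH]; first by rewrite !expr0.
by rewrite !exprS; apply: le_trans (nuM _ _) _; rewrite ler_wpM2l.
Qed.

Lemma seminorm_fps r N : 0 <= r -> seminorm (fps_norm nu r N).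
Proof.
move=> r0; split=> [|f|f g|f g]; rewrite /fps_norm.
- by rewrite big1 // => i _; rewrite fps0 nu0 mul0r.
- by apply: sumr_ge0 => i _; rewrite mulr_ge0 ?exprn_ge0.
- rewrite -big_split /= ler_sum // => i _; rewrite -mulrDl fpsD.
  by rewrite ler_wpM2r ?exprn_ge0.
- rewrite mulr_suml; under [leRHS]eq_bigr do rewrite mulr_sumr.
  pose u i j := (nu (f i) * r ^+ i) * (nu (g j) * r ^+ j).
  apply: le_trans (triangle_sum_le (u := u) N _); last first.
    by move=> i j; rewrite /u !mulr_ge0 ?exprn_ge0.
  apply: ler_sum => i _; rewrite fpsM.
  apply: (@le_trans _ _ (\sum_(k < i.+1) nu (f k) * nu (g (i - k)%N) * r ^+ i)).
    rewrite -mulr_suml ler_wpM2r ?exprn_ge0 //.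
    by apply: le_trans (seminorm_sum _ _ _) _; apply: ler_sum.
  apply: ler_sum => k _; rewrite /u mulrACA -exprD subnKC //.
  by rewrite -ltnS.
Qed.

Lemma fps_norm_leN r N M f : 0 <= r -> (N <= M)%N ->
  fps_norm nu r N f <= fps_norm nu r M f.
Proof.
move=> r0 NM; rewrite /fps_norm (@big_ord_widen _ _ _ _ M (fun i => nu (f i) * r ^+ i) NM).
rewrite [leRHS](bigID (fun j : 'I_M => j < N)%N) /=.
by rewrite lerDl sumr_ge0 // => i _; rewrite mulr_ge0 ?exprn_ge0.
Qed.

Lemma fps_norm_le_rad r s N f : 0 <= r -> r <= s ->
  fps_norm nu r N f <= fps_norm nu s N f.
Proof.
move=> r0 rs; apply: ler_sum => i _.
by rewrite ler_wpM2l // lerXn2r // nnegrE ?(le_trans r0 rs).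
Qed.

Lemma fps_norm_le_coef (nu' : A -> C) r N f g : 0 <= r ->
  (forall i, (i < N)%N -> nu (f i) <= nu' (g i)) ->
  fps_norm nu r N f <= fps_norm nu' r N g.
Proof. by move=> r0 H; apply: ler_sum => i _; rewrite ler_wpM2r ?exprn_ge0 ?H. Qed.

Lemma fps_norm_cst r N a : fps_norm nu r N (cst a) <= nu a.
Proof.
rewrite /fps_norm; case: N => [|N]; first by rewrite big_ord0.
rewrite big_ord_recl mulr1 /cst /= big1 ?addr0 // => i _.
by rewrite nu0 mul0r.
Qed.

Lemma fps_norm_var r N : 0 <= r -> fps_norm nu r N var <= nu 1 * r.
Proof.
move=> r0; rewrite /fps_norm.
(* Truncating at N + 2 guarantees that the coefficient of index 1 is present. *)
apply: (@le_trans _ _ (fps_norm nu r N.+2 var)); first by rewrite fps_norm_leN // !leqW.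
have E i : nu (var i) = (i == 1%N)%:R * nu 1.
  by rewrite /var; case: (i == 1%N); rewrite ?mul1r ?mul0r.
rewrite /fps_norm !big_ord_recl !E /= !mul0r add0r mul1r expr1 big1 ?addr0 //.
by move=> i _; rewrite mul0r.
Qed.

Lemma fps_norm_shift r N k f : 0 < r ->
  fps_norm nu r N (fun i => f (i + k)%N) <= r ^- k * fps_norm nu r (N + k) f.
Proof.
move=> r0; rewrite /fps_norm mulr_sumr addnC big_split_ord /=.
rewrite [leRHS]addrC; apply: ler_wpDr.
  apply: sumr_ge0 => i _; rewrite !mulr_ge0 ?exprn_ge0 ?(ltW r0) //.
  by rewrite invr_ge0 exprn_ge0 // ltW.
apply: ler_sum => i _; rewrite addnC exprD mulrCA mulKf //.
by rewrite expf_neq0 // gt_eqF.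
Qed.

End Seminorm.
End WeightedNorms.

(** * Series in two variables and charts of a blow-up *)

(** The outer index is the exponent of x: [f 0] is the restriction of f to x = 0, and each [f i] is
    a series in y. *)
Definition bivar (A : comNzRingType) : comNzRingType := fps (fps A).

Section Bivariate.
Variable A : comNzRingType.
Local Notation S := (bivar A).
Implicit Types f g : S.

Definition X : S := var.
Definition Y : S := cst var.
Definition K (a : A) : S := cst (cst a).

Lemma bivarM f g i j : (f * g) i j =
  \sum_(k < i.+1) \sum_(l < j.+1) f k l * g (i - k)%N (j - l)%N.
Proof. by rewrite fpsM fps_sum. Qed.

Lemma bivarM00 f g : (f * g) 0%N 0%N = f 0%N 0%N * g 0%N 0%N.
Proof. by rewrite !fpsM0. Qed.

Lemma bivarX00 f n : (f ^+ n) 0%N 0%N = f 0%N 0%N ^+ n.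
Proof. by rewrite !fpsX0. Qed.

Lemma XE i j : X i j = ((i == 1%N) && (j == 0%N))%:R.
Proof. by rewrite /X /var; case: (i == 1%N) => /=; case: j. Qed.

Lemma YE i j : Y i j = ((i == 0%N) && (j == 1%N))%:R.
Proof. by rewrite /Y /cst; case: i. Qed.

Lemma KE a i j : K a i j = if (i == 0%N) && (j == 0%N) then a else 0.
Proof. by rewrite /K /cst; case: i. Qed.

Definition swap f : S := fun i j => f j i.
Arguments swap : simpl never.

Lemma swapK : involutive swap. Proof. by []. Qed.

Lemma swap_is_zmod_morphism : zmod_morphism swap. Proof. by []. Qed.
Lemma swap_is_monoid_morphism : monoid_morphism swap.
Proof.
split=> [|f g]; apply/funext => i; apply/funext => j.
  by rewrite /swap; case: i j => [|i] [|j].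
by rewrite /swap !bivarM exchange_big.
Qed.
HB.instance Definition _ := GRing.isZmodMorphism.Build S S swap
  swap_is_zmod_morphism.
HB.instance Definition _ := GRing.isMonoidMorphism.Build S S swap
  swap_is_monoid_morphism.

Lemma swap_X : swap X = Y.
Proof. by apply/funext=> i; apply/funext=> j; rewrite /swap XE YE andbC. Qed.
Lemma swap_Y : swap Y = X. Proof. by rewrite -swap_X swapK. Qed.

Definition chart_inf f : S := fun k => var ^+ k * f k.

Lemma chart_infE f k l : chart_inf f k l = if (k <= l)%N then f k (l - k)%N else 0.
Proof. exact: varXM. Qed.

Lemma chart_inf_is_zmod_morphism : zmod_morphism chart_inf.
Proof. by move=> f g; apply/funext => k; rewrite /chart_inf !fpsD mulrDr mulrN. Qed.
Lemma chart_inf_is_monoid_morphism : monoid_morphism chart_inf.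
Proof.
split=> [|f g]; apply/funext => k.
  by rewrite /chart_inf fps1; case: k => [|k]; rewrite ?mulr0 // mul1r.
rewrite /chart_inf !fpsM mulr_sumr; apply: eq_bigr => a _.
by rewrite mulrACA -exprD subnKC // -ltnS.
Qed.
HB.instance Definition _ := GRing.isZmodMorphism.Build S S chart_inf
  chart_inf_is_zmod_morphism.
HB.instance Definition _ := GRing.isMonoidMorphism.Build S S chart_inf
  chart_inf_is_monoid_morphism.

(* The coefficient of [x^k] in [f(x, x y)] is a polynomial in [y], which makes
   the translation [y + c] meaningful. *)
Definition diag_poly f k : {poly A} := \poly_(j < k.+1) f (k - j)%N j.

(** Conjugating [chart_inf] by [swap] gives the chart (x, x y). Through this identity [diag_poly]
    inherits additivity and multiplicativity from a ring morphism, without manipulating double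
    sums. *)
Lemma of_poly_diag f k : of_poly (diag_poly f k) = swap (chart_inf (swap f)) k.
Proof.
by apply/funext => l; rewrite /of_poly coef_poly /swap chart_infE ltnS.
Qed.

Lemma of_poly_inj : injective (@of_poly A).
Proof. by move=> p q pq; apply/polyP => i; have := congr1 (fun u => u i) pq. Qed.

Definition chart c f : S := fun k => of_poly (diag_poly f k \Po ('X + c%:P)).

Lemma diag_polyB f g k : diag_poly (f - g) k = diag_poly f k - diag_poly g k.
Proof. by apply: of_poly_inj; rewrite rmorphB /= !of_poly_diag !rmorphB. Qed.

Lemma diag_polyM f g k :
  diag_poly (f * g) k = \sum_(a < k.+1) diag_poly f a * diag_poly g (k - a)%N.
Proof.
apply: of_poly_inj; rewrite rmorph_sum /= of_poly_diag !rmorphM fpsM.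
by apply: eq_bigr => a _; rewrite rmorphM /= !of_poly_diag.
Qed.

Lemma diag_poly1 k : diag_poly 1 k = (k == 0%N)%:R.
Proof. by apply: of_poly_inj; rewrite of_poly_diag !rmorph1 fps1 rmorph_nat. Qed.

Variable c : A.

Lemma chart_is_zmod_morphism : zmod_morphism (chart c).
Proof.
by move=> f g; apply/funext => k; rewrite /chart diag_polyB comp_polyB rmorphB.
Qed.
HB.instance Definition _ := GRing.isZmodMorphism.Build S S (chart c)
  chart_is_zmod_morphism.

Lemma chartE f k l : chart c f k l =
  \sum_(j < k.+1) f (k - j)%N j * (c ^+ (j - l) *+ 'C(j, l)).
Proof.
rewrite /chart /of_poly comp_polyE.
transitivity (\sum_(j < k.+1) (diag_poly f k)`_j * (('X + c%:P) ^+ j)`_l).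
  rewrite coef_sum (@big_ord_widen _ _ _ _ k.+1 (fun j => ((diag_poly f k)`_j
    *: ('X + c%:P) ^+ j)`_l) (size_poly _ _)) big_mkcond.
  apply: eq_bigr => j _; rewrite coefZ; case: ltnP => // le.
  by rewrite nth_default // mul0r.
apply: eq_bigr => j _; rewrite coef_poly ltn_ord; congr (_ * _).
rewrite addrC exprDn coef_sum.
rewrite (eq_bigr (fun i : 'I_j.+1 => if l == i then c ^+ (j - l) *+ 'C(j, l) else 0)).
  rewrite -big_mkcond /=; case: (leqP l j) => lj.
    by rewrite (big_pred1 (Ordinal (lj : (l < j.+1)%N))).
  by rewrite bin_small // mulr0n big1.
move=> i _; rewrite coefMn -rmorphXn coefCM coefXn.
by case: eqVneq => [->|]; rewrite ?mulr1 ?mulr0 ?mul0rn.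
Qed.

End Bivariate.

Arguments X {A}.
Arguments Y {A}.

Section ChartHom.
Variables (A : comNzRingType) (c : A).
Local Notation S := (bivar A).

Lemma chart_is_monoid_morphism : monoid_morphism (chart c : S -> S).
Proof.
split=> [|f g]; apply/funext => k.
  rewrite /chart diag_poly1 fps1; case: (k == 0%N).
    by rewrite comp_polyC rmorph1.
  by rewrite comp_poly0 rmorph0.
rewrite /chart diag_polyM fpsM raddf_sum /= rmorph_sum.
by apply: eq_bigr => a _; rewrite comp_polyM rmorphM.
Qed.
HB.instance Definition _ := GRing.isMonoidMorphism.Build S S (chart c)
  chart_is_monoid_morphism.

Lemma chart_X : chart c (X : S) = X.
Proof.
apply/funext => k; apply/funext => l; rewrite chartE.
rewrite big_ord_recl big1 ?addr0 => [|i _]; last by rewrite XE andbF mul0r.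
rewrite !XE subn0 andbT; case: l => [|l] /=; first by rewrite mulr1 andbT.
by rewrite mulr0 andbF.
Qed.

Lemma chart_K (a : A) : chart c (K a) = K a.
Proof.
apply/funext => k; apply/funext => l; rewrite chartE.
rewrite big_ord_recl big1 ?addr0 => [|i _]; last by rewrite KE andbF mul0r.
rewrite subn0 !KE andbT; case: (k == 0%N) => /=; last by rewrite mul0r.
by case: l => [|l] /=; rewrite ?mulr1 ?mulr0.
Qed.

Lemma chart_Y : chart c (Y : S) = X * (Y + K c).
Proof.
apply/funext => k; apply/funext => l; rewrite chartE.
rewrite /X varM; case: k => [|k].
  by rewrite big_ord1 /= YE mul0r.
rewrite big_ord_recl /= YE andbF mul0r add0r.
rewrite big_ord_recl /= YE /bump /= !subSS subn0 andbT big1 ?addr0; last first.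
  by move=> i _; rewrite YE /bump /= andbF mul0r.
rewrite !fpsD YE /K /cst; case: k => [|k] /=; last by rewrite !mul0r add0r.
by case: l => [|[|l]] /=; rewrite ?mul1r ?add0r ?addr0 // mulr0n.
Qed.

(** The translation is undone by y - c, and [f i j] is the coefficient of y^j in
    [diag_poly f (i + j)]. *)
Lemma chart_inj : injective (chart c : S -> S).
Proof.
move=> f g fg; apply/funext => i; apply/funext => j.
have := congr1 (fun u : S => u (i + j)%N) fg => /of_poly_inj.
move/(congr1 (fun p => p \Po ('X - c%:P))).
rewrite -!comp_polyA comp_polyD comp_polyX comp_polyC subrK !comp_polyXr.
move/(congr1 (fun p : {poly A} => p`_j)).
by rewrite !coef_poly ltnS leq_addl addnK.
Qed.

Lemma chart_inf_Y : chart_inf (Y : S) = Y.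
Proof.
apply/funext => k; rewrite /chart_inf /Y /cst; case: k => [|k] /=.
  by rewrite mul1r.
by rewrite mulr0.
Qed.

Lemma chart_inf_X : chart_inf (X : S) = X * Y.
Proof.
rewrite mulrC; apply/funext => k; rewrite /chart_inf cstM /X /var.
by case: eqVneq => [->|]; rewrite ?expr1 ?mulr0.
Qed.

Lemma chart_inf_K (a : A) : chart_inf (K a) = K a.
Proof.
apply/funext => k; rewrite /chart_inf /K /cst; case: k => [|k] /=.
  by rewrite mul1r.
by rewrite mulr0.
Qed.

Lemma swap_chart_inf f : swap (chart_inf (swap f)) = chart 0 f :> S.
Proof.
apply/funext => k; rewrite /chart addr0 comp_polyXr; exact/esym/of_poly_diag.
Qed.

Lemma chart_00 f : chart c f 0%N 0%N = f 0%N 0%N.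
Proof. by rewrite chartE big_ord1 bin0 expr0 !subn0 mulr1. Qed.

Lemma chart_inf_00 (f : S) : chart_inf f 0%N 0%N = f 0%N 0%N.
Proof. by rewrite chart_infE. Qed.

End ChartHom.

(** * Convergence *)

Section Convergence.
Variable R : realType.
Local Notation C := R[i].
Local Notation S := (bivar C).
Implicit Types (f g h : S) (r s t M : C).

Lemma smulE (f g : series R) : smul f g = ((f : S) * (g : S))%R.
Proof. by apply/funext => i; apply/funext => j; rewrite bivarM. Qed.

Lemma soneE : sone R = (1 : S).
Proof. by apply/funext => i; apply/funext => j; rewrite /sone fps1; case: i. Qed.

Lemma sXE : sX R = (X : S).
Proof. by apply/funext => i; apply/funext => j; rewrite XE. Qed.

Lemma sYE : sY R = (Y : S).
Proof. by apply/funext => i; apply/funext => j; rewrite YE. Qed.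

Lemma spowE (f : series R) m : spow f m = ((f : S) ^+ m)%R.
Proof.
elim: m => [|m IH]; first exact: soneE.
by rewrite /spow iterS -/(spow f m) smulE IH exprS.
Qed.

Lemma pullback_some (c : C) (f : series R) : pullback (Some c) f = chart c (f : S).
Proof. by apply/funext => i; apply/funext => j; rewrite chartE. Qed.

Lemma pullback_none (f : series R) : pullback None f = chart_inf (f : S).
Proof. by apply/funext => i; apply/funext => j; rewrite chart_infE. Qed.

(** The radii r in x and s in y are separate because Weierstrass division shrinks the first while
    keeping the second. *)
Definition bnorm r s N f : C := fps_norm (fps_norm Num.norm s N) r N f.
Definition bounded r s M f := forall N, bnorm r s N f <= M.

Lemma seminorm_bnorm r s N : 0 <= r -> 0 <= s -> seminorm (bnorm r s N).
Proof.
by move=> r0 s0; do 2!apply: seminorm_fps => //; apply: seminorm_normr.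
Qed.

Lemma bnormE r N f :
  bnorm r r N f = \sum_(i < N) \sum_(j < N) `|f i j| * r ^+ (i + j).
Proof.
apply: eq_bigr => i _; rewrite mulr_suml; apply: eq_bigr => j _.
by rewrite -mulrA -exprD addnC.
Qed.

Lemma bounded_ge0 r s M f : bounded r s M f -> 0 <= M.
Proof. by move/(_ 0%N); rewrite /bnorm /fps_norm big_ord0. Qed.

Lemma bounded_rad r s r' s' M f : 0 <= r' -> r' <= r -> 0 <= s' -> s' <= s ->
  bounded r s M f -> bounded r' s' M f.
Proof.
move=> r0 rr s0 ss fM N; apply: le_trans (fM N).
have sn t : 0 <= t -> seminorm (fps_norm (Num.norm : C -> C) t N).
  by move=> t0; apply: seminorm_fps => //; apply: seminorm_normr.
apply: le_trans (fps_norm_le_rad (sn s (le_trans s0 ss)) _ _ r0 rr).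
by apply: fps_norm_le_coef => // i _; apply: (fps_norm_le_rad (seminorm_normr C)).
Qed.

Lemma bounded_le r s M f g : 0 <= r -> 0 <= s ->
  (forall i j, `|f i j| <= `|g i j|) -> bounded r s M g -> bounded r s M f.
Proof.
move=> r0 s0 fg gM N; apply: le_trans (gM N).
by do 2!apply: fps_norm_le_coef => // ? _.
Qed.

Lemma boundedD r s M M' f g : 0 <= r -> 0 <= s ->
  bounded r s M f -> bounded r s M' g -> bounded r s (M + M') (f + g).
Proof.
move=> r0 s0 fM gM N; have [_ _ nD _] := seminorm_bnorm N r0 s0.
by apply: le_trans (nD _ _) _; rewrite lerD.
Qed.

Lemma boundedM r s M M' f g : 0 <= r -> 0 <= s ->
  bounded r s M f -> bounded r s M' g -> bounded r s (M * M') (f * g).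
Proof.
move=> r0 s0 fM gM N; have [_ n0 _ nM] := seminorm_bnorm N r0 s0.
by apply: le_trans (nM _ _) _; rewrite ler_pM.
Qed.

(* The harmonic sum is a radius below both [r] and [s]; the order of [C] being
   partial, this avoids a minimum. *)
Lemma common_radius r s : 0 < r -> 0 < s ->
  exists t, [/\ 0 < t, t <= r & t <= s].
Proof.
move=> r0 s0; exists (r^-1 + s^-1)^-1.
have p : 0 < r^-1 + s^-1 by rewrite addr_gt0 ?invr_gt0.
split; first by rewrite invr_gt0.
  by rewrite -[leRHS]invrK lef_pV2 ?posrE ?invr_gt0 // lerDl invr_ge0 ltW.
by rewrite -[leRHS]invrK lef_pV2 ?posrE ?invr_gt0 // lerDr invr_ge0 ltW.
Qed.

Lemma convergentP f : convergent f <->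
  exists r s M, [/\ 0 < r, 0 < s & bounded r s M f].
Proof.
split=> [[r [M [r0 fM]]]|[r [s [M [r0 s0 fM]]]]].
  by exists r, r, M; split=> // N; rewrite bnormE.
have [t [t0 tr ts]] := common_radius r0 s0.
exists t, M; split=> // N; rewrite -bnormE.
exact: (bounded_rad (ltW t0) tr (ltW t0) ts fM).
Qed.

Lemma convergent2 f g : convergent f -> convergent g ->
  exists t M M', [/\ 0 < t, bounded t t M f & bounded t t M' g].
Proof.
move=> [r [M [r0 fM]]] [s [M' [s0 gM]]].
have [t [t0 tr ts]] := common_radius r0 s0; exists t, M, M'; split=> //.
  by apply: (bounded_rad (ltW t0) tr (ltW t0) tr) => N; rewrite bnormE.
by apply: (bounded_rad (ltW t0) ts (ltW t0) ts) => N; rewrite bnormE.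
Qed.

Lemma convergentD f g : convergent f -> convergent g -> convergent (f + g : S).
Proof.
move=> cf cg; have [t [M [M' [t0 fM gM]]]] := convergent2 cf cg.
apply/convergentP; exists t, t, (M + M'); split=> //.
by apply: boundedD; rewrite // ltW.
Qed.

Lemma convergentM f g : convergent f -> convergent g -> convergent (f * g : S).
Proof.
move=> cf cg; have [t [M [M' [t0 fM gM]]]] := convergent2 cf cg.
apply/convergentP; exists t, t, (M * M'); split=> //.
by apply: boundedM; rewrite // ltW.
Qed.

Lemma convergent_le f g : (forall i j, `|f i j| <= `|g i j|) ->
  convergent g -> convergent f.
Proof.
move=> fg [r [M [r0 gM]]]; apply/convergentP; exists r, r, M; split=> //.
by apply: (bounded_le (ltW r0) (ltW r0) fg) => N; rewrite bnormE.
Qed.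

Lemma convergentN f : convergent f -> convergent (- f : S).
Proof. by apply: convergent_le => i j; rewrite !fpsN normrN. Qed.

Lemma convergent_K (a : C) : convergent (K a : S).
Proof.
apply/convergentP; exists 1, 1, `|a|; split=> // N.
apply: le_trans (fps_norm_cst _ _ _ _) _.
  by apply: seminorm_fps => //; apply: seminorm_normr.
by apply: (fps_norm_cst (seminorm_normr C)).
Qed.

Lemma convergent1 : convergent (1 : S).
Proof.
by apply: convergent_le (convergent_K 1) => i j; rewrite KE fps1; case: i j => [|i] [|j].
Qed.

Lemma convergent_swap f : convergent f -> convergent (swap f).
Proof.
move=> [r [M [r0 fM]]]; exists r, M; split=> // N; rewrite exchange_big /=.
apply: le_trans (fM N); apply: ler_sum => i _; apply: ler_sum => j _.
by rewrite addnC.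
Qed.

Lemma convergent_X : convergent (X : S).
Proof.
apply/convergentP; exists 1, 1, 1; split=> // N.
have sn : seminorm (fps_norm (Num.norm : C -> C) 1 N).
  by apply: seminorm_fps => //; apply: seminorm_normr.
apply: le_trans (fps_norm_var sn _ _) _ => //; rewrite mulr1.
rewrite -[Z in fps_norm _ _ _ Z](rmorph1 (@cst C)).
by apply: le_trans (fps_norm_cst (seminorm_normr C) _ _ _) _; rewrite normr1.
Qed.

Lemma convergent_Y : convergent (Y : S).
Proof. by rewrite -swap_X; apply/convergent_swap/convergent_X. Qed.

Lemma convergentX f n : convergent f -> convergent (f ^+ n : S).
Proof.
move=> cf; elim: n => [|n IH]; first exact: convergent1.
by rewrite exprS; apply: convergentM.
Qed.

Lemma convergent0 : convergent (0 : S).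
Proof.
by apply: convergent_le convergent1 => i j; rewrite !fps0 normr0 normr_ge0.
Qed.

Lemma convergent_sum (I : Type) (l : seq I) (P : pred I) (F : I -> S) :
  (forall i, P i -> convergent (F i)) -> convergent (\sum_(i <- l | P i) F i : S).
Proof. by move=> cF; elim/big_ind: _; [apply: convergent0|apply: convergentD|]. Qed.

Lemma bounded_shiftY r s M k f : 0 < r -> 0 < s -> bounded r s M f ->
  bounded r s (s ^- k * M) (fun i j => f i (j + k)%N).
Proof.
move=> r0 s0 fM N; have sn t n := @seminorm_fps C _ _ (seminorm_normr C) t n.
apply: (@le_trans _ _ (s ^- k * bnorm r s (N + k)%N f)); last first.
  by rewrite ler_wpM2l // invr_ge0 exprn_ge0 // ltW.
rewrite mulr_sumr; apply: (@le_trans _ _ (\sum_(i < N) s ^- k *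
   (fps_norm Num.norm s (N + k) (f i) * r ^+ i))).
  apply: ler_sum => i _; rewrite mulrA ler_wpM2r ?exprn_ge0 ?(ltW r0) //.
  exact: (fps_norm_shift (seminorm_normr C)).
rewrite -!mulr_sumr ler_wpM2l ?invr_ge0 ?exprn_ge0 ?(ltW s0) //.
by apply: fps_norm_leN; rewrite ?leq_addr ?(ltW r0) //; apply: sn; rewrite ltW.
Qed.

Lemma convergent_shiftY k f :
  convergent f -> convergent (fun i j => f i (j + k)%N : C).
Proof.
move=> /convergentP[r [s [M [r0 s0 fM]]]].
by apply/convergentP; exists r, s, (s ^- k * M); split=> //; apply: bounded_shiftY.
Qed.

Lemma convergent_shiftX k f :
  convergent f -> convergent (fun i j => f (i + k)%N j : C).
Proof.
move=> /convergent_swap/(@convergent_shiftY k).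
exact: (@convergent_swap (fun i j => f (j + k)%N i)).
Qed.

(** For |y| <= 1 the norm of y + c is at most B = 1 + |c|. The coefficient of x^k has degree at most
    k in y + c, so the radius t / B in x absorbs the powers of B. *)
Lemma convergent_chart (c : C) f : convergent f -> convergent (chart c f).
Proof.
move=> [t [M [t0 fM]]]; pose B : C := 1 + `|c|.
have B0 : 0 < B by rewrite ltr_pwDl ?ltr01.
have B1 : 1 <= B by rewrite lerDl.
pose r := t / B; have r0 : 0 < r by rewrite divr_gt0.
have rt : r <= t by rewrite ler_pdivrMr // ler_peMr // ltW.
apply/convergentP; exists r, 1, M; split=> // N.
have sn : seminorm (fps_norm (Num.norm : C -> C) 1 N).
  by apply: seminorm_fps => //; apply: seminorm_normr.
have [nu0 nu_ge0 nuD nuM] := sn.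
set nu := fps_norm _ _ _ in sn nu0 nu_ge0 nuD nuM.
have nuC a : nu (of_poly a%:P) <= `|a|.
  apply: le_trans (fps_norm_cst (seminorm_normr C) 1 N a).
  apply: fps_norm_le_coef => // i _.
  by rewrite /of_poly coefC /cst; case: i.
have nuX j : nu (of_poly (('X + c%:P) ^+ j)) <= B ^+ j.
  rewrite rmorphXn /=; apply: le_trans (seminormX sn _ _ _) _.
    by rewrite -(rmorph1 (@of_poly C)) -polyC1; apply: le_trans (nuC 1) _; rewrite normr1.
  rewrite lerXn2r ?nnegrE // ?(ltW B0) // rmorphD /=.
  apply: le_trans (nuD _ _) _; apply: lerD (nuC c).
  have -> : of_poly ('X : {poly C}) = var :> fps C.
    by apply/funext => i; rewrite /of_poly coefX.
  apply: le_trans (fps_norm_var (seminorm_normr C) _ _) _ => //.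
  by rewrite normr1 mulr1.
pose u j i := `|f i j| * t ^+ (i + j).
have u0 i j : 0 <= u i j by rewrite mulr_ge0 ?exprn_ge0 ?(ltW t0).
apply: le_trans (fM N); rewrite exchange_big /=.
apply: le_trans (triangle_sum_le N u0).
apply: ler_sum => k _; rewrite -/nu.
have -> : chart c f k = \sum_(j < k.+1)
    of_poly (f (k - j)%N j)%:P * of_poly (('X + c%:P) ^+ j).
  rewrite /chart comp_polyE raddf_sum /=.
  rewrite (@big_ord_widen _ _ _ _ k.+1 (fun j => of_poly ((diag_poly f k)`_j
    *: ('X + c%:P) ^+ j)) (size_poly _ _)) big_mkcond /=.
  apply: eq_bigr => j _; rewrite -rmorphM /= mul_polyC.
  have -> : f (k - j)%N j = (diag_poly f k)`_j by rewrite coef_poly ltn_ord.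
  by case: ltnP => // le; rewrite nth_default // scale0r rmorph0.
apply: le_trans (ler_wpM2r _ (seminorm_sum sn _ _ _)) _.
  by rewrite exprn_ge0 // ltW.
rewrite mulr_suml; apply: ler_sum => j _.
apply: (@le_trans _ _ (`|f (k - j)%N j| * B ^+ j * r ^+ k)).
  rewrite ler_wpM2r ?exprn_ge0 ?(ltW r0) //.
  by apply: le_trans (nuM _ _) _; rewrite ler_pM ?nu_ge0.
have jk : (j <= k)%N by rewrite -ltnS.
rewrite /u subnK // -mulrA ler_wpM2l //.
apply: (@le_trans _ _ (B ^+ k * r ^+ k)).
  by rewrite ler_wpM2r ?exprn_ge0 ?(ltW r0) // ler_weXn2l.
by rewrite -exprMn /r mulrCA divff ?mulr1 // gt_eqF.
Qed.

Lemma convergent_chart_inf f : convergent f -> convergent (chart_inf f).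
Proof.
move=> cf; rewrite -[chart_inf f]swapK -[f]swapK swap_chart_inf.
by apply/convergent_swap/convergent_chart/convergent_swap.
Qed.

Lemma convergent_pullback d f : convergent f -> convergent (pullback d f).
Proof.
case: d => [c|]; first by rewrite pullback_some; apply: convergent_chart.
by rewrite pullback_none; apply: convergent_chart_inf.
Qed.

End Convergence.

(** * Weierstrass division and preparation *)

Section Weierstrass.
Variable R : realType.
Local Notation C := R[i].
Local Notation S := (bivar C).
Implicit Types (f g h q r : S).

Definition deg_lt k f := forall i j, (k <= j)%N -> f i j = 0.

Lemma bounded_X (r s : C) : 0 <= r -> 0 <= s -> bounded r s r (X : S).
Proof.
move=> r0 s0 N.
have sn : seminorm (fps_norm (Num.norm : C -> C) s N).
  by apply: seminorm_fps => //; apply: seminorm_normr.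
apply: le_trans (fps_norm_var sn _ _) _ => //; rewrite ler_piMl //.
rewrite -[Z in fps_norm _ _ _ Z](rmorph1 (@cst C)).
by apply: le_trans (fps_norm_cst (seminorm_normr C) _ _ _) _; rewrite normr1.
Qed.

Section Division.
Variables (k : nat) (g f : S).
Hypotheses (g0 : g 0%N = var ^+ k) (cg : convergent g) (cf : convergent f).

Let G : S := fun i => g i.+1.
Let T (u : S) : S := fun i j => u i (j + k)%N.

(* Writing [g = Y^k + X G] and [u = Y^k T u + low u], the series [h] with
   [h = f + op h] gives [f = T h * g + low h]. As [op] raises the degree in
   [x] and halves a suitable norm, [h] is the limit of [approx]. *)
Let op (u : S) : S := - (X * G * T u).
Let approx N : S := iter N (fun u => f + op u) 0.

Let approxS N : approx N.+1 = f + op (approx N). Proof. by []. Qed.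

Let op_local i u v : (forall a, (a <= i)%N -> u a = v a) ->
  op u i.+1 = op v i.+1.
Proof.
move=> uv; rewrite /op !fpsN -!mulrA !varM !fpsM; congr (- _).
apply: eq_bigr => a _; congr (_ * _); apply/funext => j.
by rewrite /T uv // leq_subr.
Qed.

Let op_row0 u : op u 0%N = 0.
Proof. by rewrite /op fpsN -mulrA varM oppr0. Qed.

Let approx_stable N i : (i < N)%N -> approx N.+1 i = approx N i.
Proof.
elim: N i => // N IH i iN.
rewrite [in LHS]approxS [in RHS]approxS !fpsD.
congr (_ + _); case: i iN => [|i] iN; first by rewrite !op_row0.
by apply: op_local => a ai; rewrite IH // (leq_ltn_trans ai).
Qed.

Let lim : S := fun i => approx i.+1 i.

Let lim_approx N i : (i < N)%N -> lim i = approx N i.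
Proof.
elim: N => // N IH; rewrite ltnS leq_eqVlt => /orP[/eqP -> //|iN].
by rewrite approx_stable // IH.
Qed.

Let lim_fix : lim = f + op lim.
Proof.
apply/funext => i; rewrite [in LHS]/lim approxS !fpsD; congr (_ + _).
case: i => [|i]; first by rewrite !op_row0.
by apply: op_local => a ai; rewrite -lim_approx.
Qed.

Let convergent_lim : convergent lim.
Proof.
have cG : convergent G.
  by have := convergent_shiftX 1 cg; congr convergent; apply/funext => i;
     rewrite addn1.
have [t [M [Mf [t0 GM fM]]]] := convergent2 cG cf.
have M0 := bounded_ge0 GM; have Mf0 := bounded_ge0 fM.
(* The norm of [op u] is at most r B times that of u: r comes from X, M from G, and t^-k from
   dropping y^k. With r below 1 / (2 (1 + B)) the operator halves norms, so the bound 2 Mf is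
   preserved by u -> f + op u; the summand 1 keeps the inverse meaningful when B = 0. *)
pose B : C := M * t ^- k; have B0 : 0 <= B.
  by rewrite mulr_ge0 // invr_ge0 exprn_ge0 // ltW.
have B1 : 0 < ((1 + B) * 2)^-1 by rewrite invr_gt0 mulr_gt0 // ltr_pwDl.
have [r [r0 rt rB]] := common_radius t0 B1.
have rB2 : r * B * 2 <= 1.
  have : r * ((1 + B) * 2) <= 1.
    by rewrite -ler_pdivlMr ?mul1r // mulr_gt0 // ltr_pwDl.
  apply: le_trans; rewrite mulrA ler_wpM2r // ler_wpM2l ?(ltW r0) //.
  by rewrite lerDr.
have op_half u : bounded r t (Mf * 2) u -> bounded r t Mf (op u).
  move=> uM; apply: (@bounded_le _ _ _ _ _ (X * G * T u)); rewrite ?(ltW r0) ?(ltW t0) //.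
    by move=> i j; rewrite /op !fpsN normrN.
  move=> N; have bG := bounded_rad (ltW r0) rt (ltW t0) (lexx t) GM.
  have bX := bounded_X (ltW r0) (ltW t0).
  apply: le_trans (boundedM (ltW r0) (ltW t0) (boundedM (ltW r0) (ltW t0) bX bG)
    (bounded_shiftY k r0 t0 uM) N) _.
  have -> : r * M * (t ^- k * (Mf * 2)) = Mf * (r * B * 2) by rewrite /B; ring.
  by rewrite ler_piMr.
have bf := bounded_rad (ltW r0) rt (ltW t0) (lexx t) fM.
have ba N : bounded r t (Mf * 2) (approx N).
  elim: N => [|N IH].
    apply: (@bounded_le _ _ _ _ _ f); rewrite ?(ltW r0) ?(ltW t0) //.
      by move=> i j; rewrite /approx /= !fps0 normr0.
    by move=> N; apply: le_trans (bf N) _; rewrite ler_peMr // ler1n.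
  rewrite approxS mulr_natr mulr2n.
  by apply: boundedD (bf) (op_half _ IH); rewrite ltW.
apply/convergentP; exists r, t, (Mf * 2); split=> // N.
apply: le_trans (ba N N); rewrite /bnorm.
by apply: fps_norm_le_coef => [|i iN]; rewrite ?(ltW r0) ?(lim_approx iN).
Qed.

(** The divisor restricts to y^k itself on x = 0, so the iteration inverts nothing; this allows
    inverses of units to be deduced from division. *)
Lemma weierstrass_division :
  exists q r, [/\ convergent q, convergent r, f = q * g + r & deg_lt k r].
Proof.
pose low : S := fun i j => if (j < k)%N then lim i j else 0.
exists (T lim), low; split.
- exact: convergent_shiftY convergent_lim.
- apply: convergent_le convergent_lim => i j; rewrite /low.
  by case: ifP; rewrite ?normr0.
- have gE : g = Y ^+ k + X * G.
    apply/funext => i; rewrite fpsD /Y -rmorphXn varM.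
    by case: i => [|i]; rewrite /cst /= ?addr0 ?add0r.
  have limE : lim = Y ^+ k * T lim + low.
    apply/funext => i; apply/funext => j; rewrite /Y -rmorphXn !fpsD /= cstM.
    rewrite varXM /low /T; case: leqP => kj; last by rewrite add0r.
    by rewrite subnK // addr0.
  have := lim_fix; rewrite {1}limE /op gE => E.
  apply/esym/(addrI (- (X * G * T lim))).
  rewrite [RHS]addrC -E; ring.
- by move=> i j kj; rewrite /low ltnNge kj.
Qed.

End Division.

Lemma deg_lt0 f : deg_lt 0 f -> f = 0.
Proof. by move=> f0; apply/funext => i; apply/funext => j; rewrite f0. Qed.

(** Division of 1 by f with k = 0: the remainder has y-degree below 0, hence vanishes. *)
Lemma inverse_row0_1 f : convergent f -> f 0%N = 1 ->
  exists g, convergent g /\ f * g = 1.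
Proof.
move=> cf f0.
have [q [r [cq _ E /deg_lt0 r0]]] :=
  @weierstrass_division 0 f 1 f0 cf (@convergent1 R).
by exists q; split=> //; rewrite mulrC E r0 addr0.
Qed.

Definition unit_series f := convergent f /\ f 0%N 0%N != 0.

(** Two uses of [inverse_row0_1]. The first inverts f(0, y) / a, which after [swap] has row 0 equal
    to 1; multiplying f / a by this inverse makes its restriction to x = 0 equal to 1, and the
    second use applies. *)
Lemma unit_series_inv f : unit_series f ->
  exists g, unit_series g /\ f * g = 1.
Proof.
move=> [cf f00]; pose a := f 0%N 0%N.
suff [g [cg fg]] : exists g, convergent g /\ f * g = 1.
  exists g; split=> //; split=> //; apply: contra_eq_neq (congr1 (fun u : S => u 0%N 0%N) fg).
  by move=> g0; rewrite bivarM00 g0 mulr0 eq_sym oner_eq0.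
pose e : S := cst (f 0%N * cst a^-1).
have ce : convergent e.
  apply: (@convergent_le _ _ (f * K a^-1)) => [i j|].
    case: i => [|i]; first by rewrite /e /cst /= fpsM0.
    by rewrite /e /cst /= normr0.
  by apply: convergentM (@convergent_K R _).
have [|e' [ce' ee']] := inverse_row0_1 (convergent_swap ce).
  apply/funext => -[|i]; rewrite fps1 /swap /e /cst //=.
  by rewrite mulrC cstM mulVf.
have {}ee' : e * swap e' = 1 by rewrite -[e]swapK -rmorphM ee' rmorph1.
have [||g [cg fg]] := @inverse_row0_1 (f * K a^-1 * swap e').
- apply: convergentM (convergent_swap ce').
  exact: convergentM cf (@convergent_K R _).
- rewrite !fpsM0 {1}/K /cst /=.
  have := congr1 (fun u : S => u 0%N) ee'; rewrite fpsM0 {1}/e /cst /= => ->.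
  by rewrite fps1.
- exists (K a^-1 * swap e' * g); split; last by rewrite -fg; ring.
  apply: convergentM => //; apply: convergentM; first exact: convergent_K.
  exact: convergent_swap.
Qed.

Lemma sunitP f : sunit f <-> unit_series f.
Proof.
split=> [[cf [h [_ E]]]|uf].
  split=> //; apply: contra_eq_neq E => f0; rewrite smulE soneE.
  apply/eqP => /(congr1 (fun u : S => u 0%N 0%N))/eqP.
  by rewrite bivarM00 f0 mul0r fps1 oner_eq0.
have [g [[cg _] fg]] := unit_series_inv uf; split; first by case: uf.
by exists g; split=> //; rewrite smulE soneE fg.
Qed.

Definition weierstrass k f :=
  [/\ convergent f, f 0%N = var ^+ k & deg_lt k (f - Y ^+ k)].

(** After normalising g by the inverse of e, divide y^k by it. On x = 0 the remainder, of degree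
    below k, must vanish and the quotient must be 1; so the quotient is a unit and y^k minus the
    remainder is the polynomial sought. *)
Lemma weierstrass_preparation k g (e : fps C) : convergent g ->
  g 0%N = var ^+ k * e -> e 0%N != 0 ->
  exists U H, [/\ unit_series U, weierstrass k H & g = U * H].
Proof.
move=> cg g0 e0.
have ue : unit_series (cst e : S).
  split=> //; apply: (@convergent_le _ _ (fun i j => g i (j + k)%N)).
    move=> [|i] j /=; last by rewrite /cst /= normr0.
    by rewrite g0 varXM leq_addl addnK.
  exact: convergent_shiftY.
have [e' [[ce' _] ee']] := unit_series_inv ue.
have g1 : (g * e') 0%N = var ^+ k.
  rewrite fpsM0 g0 -mulrA; have := congr1 (fun u : S => u 0%N) ee'.
  by rewrite fpsM0 => ->; rewrite mulr1.
have [q [r [cq cr E dr]]] := weierstrass_division g1 (convergentM cg ce')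
  (convergentX k (@convergent_Y R)).
have E0 : var ^+ k = q 0%N * var ^+ k + r 0%N :> fps C.
  have := congr1 (fun u : S => u 0%N) E.
  by rewrite fpsD fpsM0 g1 /Y -rmorphXn.
have r0 : r 0%N = 0.
  apply/funext => j; case: (leqP k j) => [/dr//|jk].
  have := congr1 (fun u => u j) E0; rewrite fpsD mulrC varXM leqNgt jk add0r.
  by rewrite varX (ltn_eqF jk).
move: E0; rewrite r0 addr0 -[LHS]mulr1 [RHS]mulrC => /varXI q0.
have uq : unit_series q by split; rewrite // -q0 fps1 oner_neq0.
have [q' [uq' qq']] := unit_series_inv uq.
exists (cst e * q'), (Y ^+ k - r); split.
- split; first by apply: convergentM; [case: ue|case: uq'].
  by rewrite bivarM00 mulf_neq0 //; case: uq'.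
- split.
  + by apply: convergentD; [apply/convergentX/convergent_Y|apply: convergentN].
  + by rewrite fpsD fpsN r0 subr0 /Y -rmorphXn.
  + move=> i j kj; rewrite addrC addrA addNr add0r !fpsN dr ?oppr0 //.
- rewrite E addrK.
  have -> : cst e * q' * (q * (g * e')) = (cst e * e') * (q * q') * g :> S by ring.
  by rewrite ee' qq' !mul1r.
Qed.

(** Induction on the power of x: if all lower rows of h vanish, row i of the product is y^k times
    row i of h, which has degree below k only if it is 0. *)
Lemma weierstrass_unique k H h r : weierstrass k H ->
  h * H = r -> deg_lt k r -> h = 0.
Proof.
move=> [_ H0 _] E dr; apply/funext => i.
elim/ltn_ind: i => i IH; apply/funext => j.
have := congr1 (fun u : S => u i (j + k)%N) E; rewrite dr ?leq_addl //.
rewrite fpsM big_ord_recr /= subnn big1 => [|a _]; last by rewrite IH ?mul0r.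
by rewrite add0r H0 mulrC varXM leq_addl addnK.
Qed.

End Weierstrass.

(** * Blowing up and blowing down *)

Section BlowUp.
Variable R : realType.
Local Notation C := R[i].
Local Notation S := (bivar C).
Local Notation dir := (direction R).
Implicit Types (f g h u q H : S) (d : dir) (c : C).

Lemma bivar_domain f g : f * g = 0 -> f = 0 \/ g = 0.
Proof.
apply: fps_domain; apply: fps_domain => a b /eqP.
by rewrite mulf_eq0 => /orP[]/eqP; [left|right].
Qed.

Lemma fps_domainC (a b : fps C) : a * b = 0 -> a = 0 \/ b = 0.
Proof.
apply: fps_domain => x y /eqP.
by rewrite mulf_eq0 => /orP[]/eqP; [left|right].
Qed.

Lemma bivar_mulI f g h : f <> 0 -> f * g = f * h -> g = h.
Proof.
move=> f0 fgh; apply/subr0_eq; have : f * (g - h) = 0.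
  by rewrite mulrBr fgh subrr.
by case/bivar_domain.
Qed.

Lemma unit_neq0 u : unit_series u -> u <> 0.
Proof. by case=> _ /eqP + u0; rewrite u0. Qed.

Lemma unit_seriesM f g : unit_series f -> unit_series g -> unit_series (f * g).
Proof.
move=> [cf f0] [cg g0]; split; first exact: convergentM.
by rewrite bivarM00 mulf_neq0.
Qed.

Lemma unit_seriesX f n : unit_series f -> unit_series (f ^+ n).
Proof.
move=> [cf f0]; split; first exact: convergentX.
by rewrite bivarX00 expf_neq0.
Qed.

Lemma unit_series1 : unit_series (1 : S).
Proof. by split; [exact: convergent1|rewrite fps1 oner_neq0]. Qed.

Lemma unit_seriesMP f g : convergent f -> convergent g ->
  unit_series (f * g) -> unit_series f /\ unit_series g.
Proof. by move=> cf cg [_]; rewrite bivarM00 mulf_eq0 negb_or => /andP[]. Qed.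

Lemma nonunit f : convergent f -> ~ unit_series f -> f 0%N 0%N = 0.
Proof. by move=> cf nu; apply/eqP/negPn/negP => f0; apply: nu. Qed.

Definition exc d : S := if d is Some _ then X else Y.
Definition pull d f : S := if d is Some c then chart c f else chart_inf f.

Lemma pullbackE d (f : series R) : pullback d f = pull d f.
Proof. by case: d => [c|]; rewrite ?pullback_some ?pullback_none. Qed.

Lemma exceptional_eqE d : exceptional_eq d = exc d.
Proof. by case: d => [c|]; rewrite /= ?sXE ?sYE. Qed.

Lemma pull_is_zmod_morphism d : zmod_morphism (pull d).
Proof. by case: d => [c|]; exact: rmorphB. Qed.
Lemma pull_is_monoid_morphism d : monoid_morphism (pull d).
Proof. by case: d => [c|]; split; [exact: rmorph1|exact: rmorphM|exact: rmorph1|exact: rmorphM]. Qed.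
HB.instance Definition _ d := GRing.isZmodMorphism.Build S S (pull d)
  (pull_is_zmod_morphism d).
HB.instance Definition _ d := GRing.isMonoidMorphism.Build S S (pull d)
  (pull_is_monoid_morphism d).

Lemma pull00 d f : pull d f 0%N 0%N = f 0%N 0%N.
Proof. by case: d => [c|] /=; rewrite ?chart_00 ?chart_inf_00. Qed.

Lemma convergent_pull d f : convergent f -> convergent (pull d f).
Proof. by rewrite -pullbackE; apply: convergent_pullback. Qed.

Lemma unit_pull d u : unit_series u -> unit_series (pull d u).
Proof. by move=> [cu u0]; split; rewrite ?pull00 //; apply: convergent_pull. Qed.

Lemma unit_swap u : unit_series u -> unit_series (swap u).
Proof. by move=> [cu u0]; split=> //; apply: convergent_swap. Qed.

Lemma convergent_exc d : convergent (exc d).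
Proof. by case: d => [c|]; [exact: convergent_X|exact: convergent_Y]. Qed.

(* Restriction to the exceptional curve. *)
Definition restr d f : fps C := if d is Some _ then f 0%N else swap f 0%N.

Lemma restrM d f g : restr d (f * g) = restr d f * restr d g.
Proof. by case: d => [c|]; rewrite /restr ?rmorphM fpsM0. Qed.

Lemma restr00 d f : restr d f 0%N = f 0%N 0%N. Proof. by case: d. Qed.

Lemma restr_unit d u : unit_series u -> restr d u <> 0.
Proof. by move=> [_ /eqP u0] /(congr1 (fun v => v 0%N)); rewrite restr00. Qed.

Lemma restr_mul_neq0 d f g : restr d f <> 0 -> restr d g <> 0 -> restr d (f * g) <> 0.
Proof. by move=> f0 g0; rewrite restrM => /fps_domainC[]. Qed.

Lemma exc_cancel d m n f g : restr d f <> 0 -> restr d g <> 0 ->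
  exc d ^+ m * f = exc d ^+ n * g -> m = n /\ f = g.
Proof.
case: d => [c|] f0 g0 /=; first exact: varX_row0.
move/(congr1 (@swap C)); rewrite !rmorphM !rmorphXn /= swap_Y.
by case/(varX_row0 f0 g0) => -> /(congr1 (@swap C)); rewrite !swapK.
Qed.

Definition irreducible f := [/\ convergent f, f <> 0, ~ unit_series f &
  forall g h, convergent g -> convergent h -> f = g * h ->
    unit_series g \/ unit_series h].

Lemma plane_branchP (f : series R) : plane_branch f <-> irreducible f.
Proof.
split=> [[cf f0 nu H]|[cf f0 nu H]]; split=> //.
- by move=> /sunitP.
- move=> g h cg ch fE; rewrite -!sunitP; apply: H => //.
  by rewrite smulE.
- by move=> /sunitP.
- by move=> g h cg ch fE; rewrite !sunitP; apply: H; rewrite // fE smulE.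
Qed.

Lemma irreducible00 f : irreducible f -> f 0%N 0%N = 0.
Proof. by case=> cf _ nu _; apply: nonunit. Qed.

Lemma irreducible_unitM u f : unit_series u -> irreducible f -> irreducible (u * f).
Proof.
move=> uu [cf f0 nu H]; have cu : convergent u by case: uu.
split.
- exact: convergentM.
- by move/bivar_domain => [/(unit_neq0 uu)|].
- by move/(unit_seriesMP cu cf) => [].
- move=> g h cg ch E; have [v [uv uvE]] := unit_series_inv uu.
  have cv : convergent v by case: uv.
  have : f = (v * g) * h by rewrite -mulrA -E mulrA [v * u]mulrC uvE mul1r.
  move/(H _ _ (convergentM cv cg) ch) => [/(unit_seriesMP cv cg)[]|]; by [left|right].
Qed.

Lemma irreducible_swap f : irreducible f -> irreducible (swap f).
Proof.
move=> [cf f0 nu H]; split.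
- exact: convergent_swap.
- by move/(congr1 (@swap C)); rewrite swapK rmorph0.
- by move/unit_swap; rewrite swapK.
- move=> g h cg ch /(congr1 (@swap C)); rewrite swapK rmorphM => E.
  by have [] := H _ _ (convergent_swap cg) (convergent_swap ch) E;
    move/unit_swap; rewrite swapK => ?; [left|right].
Qed.

(* [blowup d m f g]: the multiplicity of [f] is [m], [d] is its only tangent
   direction, and [g] is, up to a unit, its strict transform there. *)
Definition blowup d m f g :=
  (exists2 u, unit_series u & pull d f = exc d ^+ m * (u * g)) /\
  forall d', d' <> d -> exists2 u, unit_series u & pull d' f = exc d' ^+ m * u.

Lemma blowup_unitM d m u f g : unit_series u -> blowup d m f g -> blowup d m (u * f) g.
Proof.
move=> uu [[v uv fE] H]; split=> [|d' /H[w uw E]].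
  exists (pull d u * v); first exact: unit_seriesM (unit_pull _ uu) uv.
  by rewrite rmorphM /= fE; ring.
exists (pull d' u * w); first exact: unit_seriesM (unit_pull _ uu) uw.
by rewrite rmorphM /= E; ring.
Qed.

Lemma blowup_unitr d m u f g : unit_series u -> blowup d m f (u * g) -> blowup d m f g.
Proof.
move=> uu [[v uv fE] H]; split=> //; exists (v * u); first exact: unit_seriesM.
by rewrite fE; ring.
Qed.

Definition ycoef j H : S := fun i => cst (H i j).

Lemma convergent_ycoef j H : convergent H -> convergent (ycoef j H).
Proof.
move/(@convergent_shiftY R j); apply: convergent_le => i [|l].
  by rewrite /ycoef /cst /= add0n.
by rewrite /ycoef /cst /= normr0.
Qed.

Lemma ycoef00 j H : ycoef j H 0%N 0%N = H 0%N j. Proof. by []. Qed.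

Lemma mul_ycoef_Y j n H i l : (ycoef j H * Y ^+ n) i l = if l == n then H i j else 0.
Proof.
rewrite mulrC /Y -rmorphXn cstM varXM /ycoef /cst subn_eq0.
by case: ltngtP => // _.
Qed.

Lemma chart_row c f : (forall i j, (0 < j)%N -> f i j = 0) -> chart c f = f.
Proof.
move=> f0; apply/funext => k; apply/funext => l; rewrite chartE.
rewrite big_ord_recl big1 ?addr0 => [|i _]; last by rewrite f0 ?mul0r.
rewrite !subn0; case: l => [|l]; first by rewrite expr0 mulr1.
by rewrite bin0n mulr0n mulr0 f0.
Qed.

Lemma chart_ycoef c j H : chart c (ycoef j H) = ycoef j H.
Proof. by apply: chart_row => i [|l]. Qed.

Lemma weierstrassE k H : weierstrass k H -> H = Y ^+ k + \sum_(j < k) ycoef j H * Y ^+ j.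
Proof.
move=> [_ H0 dH]; apply/funext => i; apply/funext => l.
rewrite !fpsD !fps_sum.
under eq_bigr do rewrite mul_ycoef_Y.
rewrite -big_mkcond /=; case: (ltnP l k) => lk.
  rewrite (big_pred1 (Ordinal lk)) //= /Y -rmorphXn /= /cst.
  by case: i => [|i] /=; rewrite ?fps0 ?varX ?(ltn_eqF lk) ?mulr0n add0r.
rewrite big1 ?addr0 => [|j /eqP lj]; last first.
  by move: (ltn_ord j); rewrite -lj ltnNge lk.
by have := dH i l lk; rewrite !fpsD !fpsN => /subr0_eq.
Qed.

Lemma weierstrass_low k H j : weierstrass k H -> (j < k)%N -> H 0%N j = 0.
Proof. by case=> _ -> _ jk; rewrite varX (ltn_eqF jk). Qed.

(* The strict transform of [blowdown c k H] in the direction [1 : c] is [H]: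
   it is [x^k H(x, y / x - c)]. *)
Definition blowdown c k H : S := (Y - K c * X) ^+ k +
  \sum_(j < k) ycoef j H * X ^+ (k - j) * (Y - K c * X) ^+ j.

Lemma convergent_blowdown c k H : convergent H -> convergent (blowdown c k H).
Proof.
move=> cH; have cL : convergent (Y - K c * X : S).
  apply: convergentD; first exact: convergent_Y.
  by apply/convergentN/convergentM; [exact: convergent_K|exact: convergent_X].
apply: convergentD; first exact: convergentX.
apply: convergent_sum => j _; apply: convergentM; last exact: convergentX.
by apply: convergentM; [exact: convergent_ycoef|exact/convergentX/convergent_X].
Qed.

Lemma blowdown_row0 c k H : blowdown c k H 0%N = var ^+ k.
Proof.
rewrite /blowdown fpsD fps_sum big1 ?addr0 => [|j _].
  rewrite fpsX0 fpsD fpsN fpsM0 /= /X /var /= mulr0 subr0 //.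
by rewrite !fpsM0 fpsX0 /X /var /= expr0n subn_eq0 leqNgt ltn_ord mulr0 mul0r.
Qed.

Lemma exprn_splitl f k (j : 'I_k) : f ^+ k = f ^+ (k - j) * f ^+ j.
Proof. by rewrite -exprD subnK // ltnW. Qed.

Lemma chart_blowdown c c' k H : chart c' (blowdown c k H) = X ^+ k *
  ((Y + K (c' - c)) ^+ k + \sum_(j < k) ycoef j H * (Y + K (c' - c)) ^+ j).
Proof.
have lin : chart c' (Y - K c * X : S) = X * (Y + K (c' - c)).
  rewrite rmorphB rmorphM /= chart_X chart_Y chart_K.
  rewrite /K !rmorphB /=; ring.
rewrite /blowdown rmorphD rmorph_sum /= rmorphXn /= lin exprMn mulrDr mulr_sumr.
congr (_ + _); apply: eq_bigr => j _.
rewrite !rmorphM !rmorphXn /= lin chart_ycoef chart_X exprMn.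
by rewrite [Z in _ = Z * _](exprn_splitl _ j); ring.
Qed.

Lemma chart_inf_blowdown c k H : chart_inf (blowdown c k H) = Y ^+ k *
  ((1 - K c * X) ^+ k + \sum_(j < k) chart_inf (ycoef j H) *
     X ^+ (k - j) * (1 - K c * X) ^+ j).
Proof.
have lin : chart_inf (Y - K c * X : S) = Y * (1 - K c * X).
  by rewrite rmorphB rmorphM /= chart_inf_X chart_inf_Y chart_inf_K; ring.
rewrite /blowdown rmorphD rmorph_sum /= rmorphXn /= lin exprMn mulrDr mulr_sumr.
congr (_ + _); apply: eq_bigr => j _.
rewrite !rmorphM !rmorphXn /= lin chart_inf_X !exprMn.
by rewrite [Z in _ = Z * _](exprn_splitl _ j); ring.
Qed.

(** The transform in direction [1 : c'] is H(x, y + c' - c), with value (c' - c)^k at the origin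
    because H(0, y) = y^k. It is thus H for c' = c and a unit otherwise; in direction [0 : 1] the
    value is 1. *)
Lemma blowdown_blowup c k H : weierstrass k H -> blowup (Some c) k (blowdown c k H) H.
Proof.
move=> wH; have cH : convergent H by case: wH.
have E d : pull d (blowdown c k H) = exc d ^+ k * match d with
  | Some c' => (Y + K (c' - c)) ^+ k + \sum_(j < k) ycoef j H * (Y + K (c' - c)) ^+ j
  | None => (1 - K c * X) ^+ k + \sum_(j < k) chart_inf (ycoef j H) *
     X ^+ (k - j) * (1 - K c * X) ^+ j end.
  by case: d => [c'|] /=; rewrite ?chart_blowdown ?chart_inf_blowdown.
split=> [|[c'|] cc'].
- exists 1; first exact: unit_series1.
  rewrite E mul1r [in RHS](weierstrassE wH) subrr.
  by rewrite /K !rmorph0 addr0.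
- rewrite E; eexists; last by [].
  split.
    apply: convergentD => [|].
      by apply/convergentX/convergentD; [exact: convergent_Y|exact: convergent_K].
    apply: convergent_sum => j _; apply: convergentM; first exact: convergent_ycoef.
    by apply/convergentX/convergentD; [exact: convergent_Y|exact: convergent_K].
  rewrite !fpsD !fps_sum big1 ?addr0 => [|j _]; last first.
    by rewrite bivarM00 ycoef00 (weierstrass_low wH) ?mul0r.
  rewrite bivarX00 !fpsD YE KE /= add0r expf_neq0 // subr_eq0.
  by apply/eqP => c'c; apply: cc'; rewrite c'c.
- rewrite E; eexists; last by [].
  have c1 : convergent (1 - K c * X : S).
    apply: convergentD; first exact: convergent1.
    by apply/convergentN/convergentM; [exact: convergent_K|exact: convergent_X].
  split.
    apply: convergentD; first exact: convergentX.
    apply: convergent_sum => j _; apply: convergentM; last exact: convergentX.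
    apply: convergentM; last exact/convergentX/convergent_X.
    exact/convergent_chart_inf/convergent_ycoef.
  rewrite !fpsD !fps_sum big1 ?addr0 => [|j _]; last first.
    by rewrite !bivarM00 chart_inf_00 ycoef00 (weierstrass_low wH) ?mul0r.
  by rewrite bivarX00 !fpsD !fpsN fps1 bivarM00 XE mulr0 subr0 expr1n oner_neq0.
Qed.

(** Exchanging the coordinates carries direction [1 : 0] to [0 : 1]. The finite directions do not
    correspond to each other in matching charts, so their units are computed directly. *)
Lemma blowdown_blowup_inf k H : weierstrass k H ->
  blowup None k (swap (blowdown 0 k H)) (swap H).
Proof.
move=> wH; have cH : convergent H by case: wH.
have [[u uu /= E] _] := blowdown_blowup 0 wH.
split=> [|[c'|] cc'] //.
  exists (swap u); first exact: unit_swap.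
  rewrite /pull -[chart_inf _]swapK swap_chart_inf E.
  by rewrite !rmorphM rmorphXn /= swap_X.
exists (1 + \sum_(j < k) chart c' (swap (ycoef j H)) * (Y + K c') ^+ (k - j)).
  split.
    apply: convergentD; first exact: convergent1.
    apply: convergent_sum => j _; apply: convergentM.
      exact/convergent_chart/convergent_swap/convergent_ycoef.
    by apply/convergentX/convergentD; [exact: convergent_Y|exact: convergent_K].
  rewrite !fpsD !fps_sum big1 ?addr0 ?fps1 ?oner_neq0 // => j _.
  by rewrite bivarM00 chart_00 /swap ycoef00 (weierstrass_low wH) ?mul0r.
have -> : swap (blowdown 0 k H) = X ^+ k +
    \sum_(j < k) swap (ycoef j H) * Y ^+ (k - j) * X ^+ j.
  rewrite /blowdown /K !rmorph0 mul0r subr0 rmorphD rmorph_sum /= rmorphXn /=.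
  rewrite swap_Y; congr (_ + _); apply: eq_bigr => j _.
  by rewrite !rmorphM !rmorphXn /= swap_X swap_Y.
rewrite rmorphD rmorph_sum /= rmorphXn /= chart_X mulrDr mulr1 mulr_sumr.
congr (_ + _); apply: eq_bigr => j _.
rewrite !rmorphM !rmorphXn /= chart_X chart_Y.
by rewrite exprMn [Z in _ = Z * _](exprn_splitl _ j); ring.
Qed.

End BlowUp.

(** * Tangents of irreducible germs *)

Section Tangent.
Variable R : realType.
Local Notation C := R[i].
Local Notation S := (bivar C).
Local Notation dir := (direction R).
Implicit Types (f g h u q H : S) (d : dir) (c : C).

Lemma diag_poly0 f i : diag_poly f i = 0 <->
  forall j, (j <= i)%N -> f (i - j)%N j = 0.
Proof.
split=> [E j ji|f0].
  by have := congr1 (fun p : {poly C} => p`_j) E; rewrite coef_poly ltnS ji coef0.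
by apply/polyP => j; rewrite coef_poly coef0 ltnS; case: leqP => // /f0.
Qed.

Lemma diag_poly_swap0 f i : diag_poly f i = 0 -> diag_poly (swap f) i = 0.
Proof.
move/diag_poly0 => f0; apply/diag_poly0 => j ji.
by have := f0 (i - j)%N (leq_subr _ _); rewrite subKn.
Qed.

Lemma comp_translate_neq0 (p : {poly C}) c : p <> 0 -> p \Po ('X + c%:P) <> 0.
Proof.
move=> p0 /(congr1 (fun p => p \Po ('X - c%:P))).
by rewrite -comp_polyA comp_polyD comp_polyX comp_polyC subrK comp_polyXr comp_poly0.
Qed.

(** [diag_poly f m] is the initial form of f with x set to 1. Its degree of homogeneity m is the
    exponent of the exceptional curve in every chart, and its zeros are the tangent directions. *)
Lemma multiplicity f : convergent f -> f <> 0 -> exists m,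
  (forall d, exists f', [/\ convergent f', pull d f = exc d ^+ m * f' & restr d f' <> 0]) /\
  (f 0%N 0%N = 0 -> (0 < m)%N /\ exists t f', [/\ convergent f',
     pull t f = exc t ^+ m * f', restr t f' <> 0 & f' 0%N 0%N = 0]).
Proof.
move=> cf f0; have exm : exists m, diag_poly f m != 0.
  apply: contrapT => H; apply: f0; apply/funext => i; apply/funext => j.
  have /eqP/diag_poly0/(_ j) : diag_poly f (i + j) == 0.
    by apply/negPn/negP => E; apply: H; exists (i + j)%N.
  by rewrite leq_addl addnK; apply.
case: (ex_minnP exm) => m fm mmin; exists m.
have low i : (i < m)%N -> diag_poly f i = 0.
  by move=> im; apply/eqP; apply: contraTT im => /mmin; rewrite -leqNgt.
have chart_low g c : convergent g -> (forall i, (i < m)%N -> diag_poly g i = 0) ->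
    diag_poly g m <> 0 -> exists g', [/\ convergent g', chart c g = X ^+ m * g',
      g' 0%N = of_poly (diag_poly g m \Po ('X + c%:P)) & g' 0%N <> 0].
  move=> cg g0 gm; exists (fun i => chart c g (i + m)%N); split=> //.
  - exact: (@convergent_shiftX R m _ (convergent_chart c cg)).
  - by apply: fps_shift => i im; rewrite /chart g0 // comp_poly0 rmorph0.
  - rewrite /= /chart add0n -[0](rmorph0 (@of_poly C)) => /of_poly_inj.
    exact: comp_translate_neq0.
have sm : diag_poly (swap f) m <> 0.
  by move/diag_poly_swap0; rewrite swapK; apply/eqP.
have slow i : (i < m)%N -> diag_poly (swap f) i = 0 by move/low/diag_poly_swap0.
have tr c := chart_low f c cf low (elimN eqP fm).
have [s' [cs' sE s0 sn]] := chart_low (swap f) 0 (convergent_swap cf) slow sm.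
have infE : chart_inf f = Y ^+ m * swap s'.
  rewrite -[LHS]swapK -[in LHS](swapK f) swap_chart_inf sE rmorphM rmorphXn /=.
  by rewrite swap_X.
split=> [[c|]|f00].
- by have [f' [cf' fE _ fn]] := tr c; exists f'.
- by exists (swap s'); split=> //; apply: convergent_swap.
have m0 : (0 < m)%N.
  rewrite lt0n; apply: contra fm => /eqP ->; apply/eqP/diag_poly0 => j.
  by rewrite leqn0 => /eqP ->.
(* If y^m is missing from the initial form, [0 : 1] is a tangent. Otherwise the dehomogenised form
   has degree m > 0, hence a complex root. *)
split=> //; have [fY|fY] := eqVneq (f 0%N m) 0.
  exists None, (swap s'); split=> //; first exact: convergent_swap.
  rewrite /swap s0 /of_poly addr0 comp_polyXr coef_poly /= subn0.
  exact: fY.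
have sz : size (diag_poly f m) = m.+1.
  by apply: size_poly_eq; rewrite subnn.
have [c] : exists c, root (diag_poly f m) c.
  by apply/closed_rootP; rewrite sz; case: (m) m0.
move/eqP => pc; have [f' [cf' fE fr fn]] := tr c.
exists (Some c), f'; split=> //; rewrite fr /of_poly.
by rewrite -horner_coef0 horner_comp !hornerE.
Qed.

Lemma fps_row_factor (a : fps C) : a <> 0 -> a 0%N = 0 ->
  exists k (e : fps C), [/\ (0 < k)%N, a = var ^+ k * e & e 0%N != 0].
Proof.
move=> /fps_val[[|k] [e [-> /eqP e0]]] a0; last by exists k.+1, e.
by move/eqP: e0; rewrite mul1r in a0.
Qed.

(** If a Weierstrass polynomial H of positive degree divides the strict transform g', then its
    blow-down divides g, hence equals g up to a unit. Applied to the polynomial prepared from g'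
    this describes g and g'; applied to a factor of g' it shows that the other factor is a unit. *)
Lemma irreducible_tangent g c m g' : irreducible g -> convergent g' ->
  chart c g = X ^+ m * g' -> g' 0%N <> 0 -> g' 0%N 0%N = 0 ->
  exists q H, [/\ (0 < m)%N, unit_series q, weierstrass m H,
    g = q * blowdown c m H & g' = chart c q * H] /\ irreducible g'.
Proof.
move=> [cg g0 nug irrg] cg' gE rg' g'0.
have key k H (W : S) : (0 < k)%N -> weierstrass k H -> convergent W -> g' = W * H ->
    exists q, [/\ unit_series q, g = q * blowdown c k H, k = m & g' = chart c q * H].
  move=> k0 wH cW g'E; have cH : convergent H by case: wH.
  have cB := convergent_blowdown c k cH.
  have [q [r [cq cr E dr]]] := weierstrass_division (blowdown_row0 c k H) cB cg.
  have bE : chart c (blowdown c k H) = X ^+ k * H.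
    by rewrite chart_blowdown subrr /K !rmorph0 addr0 -[in LHS](weierstrassE wH).
  have E' : (X ^+ m * W - chart c q * X ^+ k) * H = chart c r.
    have := congr1 (chart c) E; rewrite rmorphD rmorphM /= bE gE g'E => E1.
    by rewrite mulrBl -mulrA E1; ring.
  (* The substitution (x, x (y + c)) does not raise the y-degree, so the remainder becomes a
     multiple of H of degree below k, hence 0. *)
  have dr' : deg_lt k (chart c r).
    move=> i l kl; rewrite chartE big1 // => j _.
    case: (leqP k j) => [kj|jk]; first by rewrite dr // mul0r.
    by rewrite bin_small ?mulr0n ?mulr0 // (leq_trans jk).
  have r0 : r = 0.
    apply: (@chart_inj _ c); rewrite rmorph0 -E'.
    by rewrite (weierstrass_unique wH E' dr') mul0r.
  rewrite r0 addr0 in E.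
  have uq : unit_series q.
    have [//|[_]] := irrg _ _ cq cB E.
    by rewrite blowdown_row0 varX (ltn_eqF k0) eqxx.
  have cq0 := unit_pull (Some c) uq.
  have E2 : X ^+ m * g' = X ^+ k * (chart c q * H).
    by rewrite -gE E rmorphM /= bE; ring.
  have rq : (chart c q * H) 0%N <> 0.
    rewrite fpsM0; case: wH => _ -> _; rewrite mulrC => rq.
    have [_ /eqP] := cq0; apply.
    have := congr1 (fun u : fps C => u k) rq; rewrite varXM leqnn subnn fps0.
    by [].
  have [mk g'q] := varX_row0 rg' rq E2.
  by exists q.
have [k [e [k0 g'r e0]]] := fps_row_factor rg' g'0.
have [U [H [uU wH g'E]]] := weierstrass_preparation cg' g'r e0.
have cU : convergent U by case: uU.
have [q [uq gq km g'q]] := key k H U k0 wH cU g'E; subst k.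
exists q, H; split=> //; split=> //.
- by move=> E; apply: rg'; rewrite E.
- by case=> _ /eqP.
move=> h1 h2 ch1 ch2 hE.
have [/eqP h10|] := eqVneq (h1 0%N 0%N) 0; last by left.
right; have r1 : h1 0%N <> 0.
  by move=> r1; apply: rg'; rewrite hE fpsM0 r1 mul0r.
have [k1 [e1 [k10 h1r e10]]] := fps_row_factor r1 (eqP h10).
have [U1 [H1 [uU1 wH1 h1E]]] := weierstrass_preparation ch1 h1r e10.
have cU1 : convergent U1 by case: uU1.
have [|q1 [uq1 _ _ g'1]] := key k1 H1 (h2 * U1) k10 wH1 (convergentM ch2 cU1).
  by rewrite hE h1E; ring.
have H10 : H1 <> 0 by move=> H10; apply: r1; rewrite h1E H10 mulr0.
suff E : h2 * U1 = chart c q1.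
  have := unit_pull (Some c) uq1; rewrite /= -E.
  by case/(unit_seriesMP ch2 cU1).
by apply: (bivar_mulI H10); rewrite [RHS]mulrC -g'1 hE h1E; ring.
Qed.

(** The last two conditions say that the strict transform meets the exceptional curve with
    intersection number exactly m. This is how transversality will yield m = 1 in [nc_of_blowup]. *)
Lemma blowup_irreducible g : irreducible g -> exists t m g' (a : fps C),
  [/\ (0 < m)%N, irreducible g', blowup t m g g', restr t g' = var ^+ m * a
    & a 0%N != 0].
Proof.
move=> ig; have [cg gn _ _] := ig.
have [m [_ /(_ (irreducible00 ig))[m0 [t [g' [cg' gE rg' g'0]]]]]] := multiplicity cg gn.
case: t gE rg' => [c|] /= gE rg'.
  have [q [H [[_ uq wH gq g'q] ig']]] := irreducible_tangent ig cg' gE rg' g'0.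
  have ucq := unit_pull (Some c) uq.
  exists (Some c), m, g', (chart c q 0%N); split=> //.
  - rewrite gq; apply: blowup_unitM => //; rewrite g'q.
    have [v [uv vq]] := unit_series_inv ucq.
    apply: (@blowup_unitr _ _ _ v) => //.
    by rewrite mulrA [v * _]mulrC vq mul1r; apply: blowdown_blowup.
  - by rewrite /= g'q fpsM0; case: wH => _ -> _; rewrite mulrC.
  - by case: ucq.
have sE : chart 0 (swap g) = X ^+ m * swap g'.
  by rewrite -swap_chart_inf swapK gE rmorphM rmorphXn /= swap_Y.
have [q [H [[_ uq wH gq g'q] ig']]] :=
  irreducible_tangent (irreducible_swap ig) (convergent_swap cg') sE rg' g'0.
have ucq := unit_pull (Some 0) uq.
exists None, m, g', (chart 0 q 0%N); split=> //.
- by rewrite -[g']swapK; apply: irreducible_swap.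
- rewrite -[g]swapK gq rmorphM; apply: blowup_unitM; first exact: unit_swap.
  rewrite -[g']swapK g'q rmorphM.
  have [v [uv vq]] := unit_series_inv (unit_swap ucq).
  apply: (@blowup_unitr _ _ _ v) => //.
  by rewrite mulrA [v * _]mulrC vq mul1r; apply: blowdown_blowup_inf.
- by rewrite /= g'q fpsM0; case: wH => _ -> _; rewrite mulrC.
- by case: ucq.
Qed.

(** A non-unit factor has some tangent direction, and a tangent of a factor is a tangent of f; only
    d is available. *)
Lemma blowup_factor_nonunit d m f g h1 h2 : blowup d m f g -> f <> 0 ->
  f = h1 * h2 -> convergent h1 -> convergent h2 -> h1 0%N 0%N = 0 ->
  exists m1 h1', [/\ convergent h1', pull d h1 = exc d ^+ m1 * h1',
    restr d h1' <> 0 & h1' 0%N 0%N = 0].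
Proof.
move=> [_ B] f0 fE c1 c2 h10.
have h1n : h1 <> 0 by move=> E; apply: f0; rewrite fE E mul0r.
have h2n : h2 <> 0 by move=> E; apply: f0; rewrite fE E mulr0.
have [m1 [_ /(_ h10)[_ [t [h1' [ch1' E1 r1 h1'0]]]]]] := multiplicity c1 h1n.
have [td|/eqP td] := eqVneq t d; first by subst t; exists m1, h1'.
have [m2 [/(_ t)[h2' [ch2' E2 r2]] _]] := multiplicity c2 h2n.
have [u uu E] := B _ td.
have := E; rewrite fE rmorphM /= E1 E2 mulrACA -exprD => E'.
have [_ uE] := exc_cancel (restr_mul_neq0 r1 r2) (restr_unit uu) E'.
by case: uu => _; rewrite -uE bivarM00 h1'0 mul0r eqxx.
Qed.

(** If f had two non-unit factors, both strict transforms would pass through the point of direction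
    d and split g up to a unit. *)
Lemma blowup_of_irreducible d m f g : convergent f -> blowup d m f g ->
  (0 < m)%N -> f 0%N 0%N = 0 -> irreducible g -> restr d g <> 0 -> irreducible f.
Proof.
move=> cf B m0 f00 ig rg; have [[u uu fE] _] := B.
have iug := irreducible_unitM uu ig.
have rug : restr d (u * g) <> 0 by apply: restr_mul_neq0 => //; apply: restr_unit.
have f0 : f <> 0.
  move=> E; move: fE; rewrite E rmorph0 => /esym E0; apply: rug.
  suff -> : u * g = 0 by case: (d).
  case: (bivar_domain E0) => //.
  have : (exc d : S) <> 0.
    by case: (d) => [?|] /(congr1 (fun w : S => w 1%N 0%N + w 0%N 1%N));
       rewrite ?XE ?YE /= ?mulr0n ?mulr1n ?addr0 ?add0r => /eqP; rewrite oner_eq0.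
  elim: m {B m0 E0} => [|m IH] e0; first by move/eqP; rewrite oner_eq0.
  by rewrite exprS => /bivar_domain[//|/IH]; apply.
split=> //; first by case=> _; rewrite f00 eqxx.
move=> h1 h2 c1 c2 E.
have [h10|] := eqVneq (h1 0%N 0%N) 0; last by left.
have [h20|] := eqVneq (h2 0%N 0%N) 0; last by right.
have [m1 [g1 [cg1 E1 r1 g10]]] := blowup_factor_nonunit B f0 E c1 c2 h10.
have [|m2 [g2 [cg2 E2 r2 g20]]] := blowup_factor_nonunit B f0 _ c2 c1 h20.
  by rewrite mulrC.
have : exc d ^+ (m1 + m2) * (g1 * g2) = exc d ^+ m * (u * g).
  by rewrite -fE E rmorphM /= E1 E2 exprD; ring.
move/(exc_cancel (restr_mul_neq0 r1 r2) rug) => [_ gE].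
have [_ _ _ /(_ g1 g2 cg1 cg2 (esym gE))] := iug.
by case=> -[_]; rewrite ?g10 ?g20 eqxx.
Qed.

(** Neither axis is a component of f. This permits preparation with respect to either variable, so
    blowing down in any direction, and it survives blowing down. *)
Definition off_axes f := restr (Some 0) f <> 0 /\ restr None f <> 0.

(** The axis x = 0 keeps its equation in the chart [0 : 1], so f(0, y) is the restriction of the
    transform there: a power of y times a unit or times a unit and g(0, y). The chart [1 : 0] does
    the same for y = 0. *)
Lemma blowup_off_axes d m f g : blowup d m f g -> off_axes g -> off_axes f.
Proof.
move=> [[u uu fE] B] [gx gy]; split=> [f0|f0].
- have f0' : restr (Some 0) (pull None f) = 0.
    by move: f0; rewrite /= /chart_inf expr0 mul1r.
  have ex : restr (Some 0) (exc None ^+ m : S) <> 0.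
    rewrite /restr /exc fpsX0 => /(congr1 (fun u : fps C => u m)).
    by rewrite [Y 0%N]/(cst var 0%N) /cst /= varX eqxx => /eqP; rewrite oner_eq0.
  have [dN|/eqP dN] := eqVneq d None.
    move: f0'; subst d; rewrite fE; apply: restr_mul_neq0 => //.
    by apply: restr_mul_neq0 => //; apply: restr_unit.
  have [v uv vE] := B None (nesym dN).
  by move: f0'; rewrite vE; apply: restr_mul_neq0 => //; apply: restr_unit.
- have f0' : restr None (pull (Some 0) f) = 0.
    have -> : restr None (pull (Some 0) f) = var ^+ 0 * restr None f.
      by rewrite /restr /pull -swap_chart_inf swapK.
    by rewrite f0 mulr0.
  have ex : restr None (exc (Some 0) ^+ m : S) <> 0.
    rewrite /restr /exc rmorphXn /= swap_X fpsX0 => /(congr1 (fun u : fps C => u m)).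
    by rewrite [Y 0%N]/(cst var 0%N) /cst /= varX eqxx => /eqP; rewrite oner_eq0.
  have [dN|/eqP dN] := eqVneq d (Some 0).
    move: f0'; subst d; rewrite fE; apply: restr_mul_neq0 => //.
    by apply: restr_mul_neq0 => //; apply: restr_unit.
  have [v uv vE] := B (Some 0) (nesym dN).
  by move: f0'; rewrite vE; apply: restr_mul_neq0 => //; apply: restr_unit.
Qed.

Lemma blowdown_irreducible d g : irreducible g -> off_axes g ->
  exists m f, [/\ (0 < m)%N, irreducible f, off_axes f & blowup d m f g].
Proof.
move=> ig tg; suff [m [f [m0 cf f0 B]]] : exists m f, [/\ (0 < m)%N, convergent f,
    f 0%N 0%N = 0 & blowup d m f g].
  exists m, f; split=> //; last exact: blowup_off_axes B tg.
  apply: blowup_of_irreducible B _ _ ig _ => //.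
  by case: tg; case: (d).
have [cg _ _ _] := ig; have g00 := irreducible00 ig.
have prep (h : S) : convergent h -> h 0%N <> 0 -> h 0%N 0%N = 0 ->
    exists m U H, [/\ (0 < m)%N, unit_series U, weierstrass m H & H = U * h].
  move=> ch h0 h00; have [m [e [m0 hE e0]]] := fps_row_factor h0 h00.
  have [U [H [uU wH E]]] := weierstrass_preparation ch hE e0.
  have [V [uV VU]] := unit_series_inv uU.
  by exists m, V, H; split=> //; rewrite E mulrA [V * U]mulrC VU mul1r.
have b00 c m H : (0 < m)%N -> blowdown c m H 0%N 0%N = 0.
  by move=> m0; rewrite blowdown_row0 varX (ltn_eqF m0).
case: d tg => [c|] [gx gy].
  have [m [U [H [m0 uU wH E]]]] := prep g cg gx g00.
  exists m, (blowdown c m H); split; rewrite ?b00 //.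
    by apply: convergent_blowdown; case: wH.
  by apply: (blowup_unitr uU); rewrite -E; apply: blowdown_blowup.
have [m [U [H [m0 uU wH E]]]] := prep (swap g) (convergent_swap cg) gy g00.
exists m, (swap (blowdown 0 m H)); split; rewrite ?[swap _ _ _]b00 //.
  by apply/convergent_swap/convergent_blowdown; case: wH.
apply: (blowup_unitr (unit_swap uU)).
by rewrite -[g]swapK -rmorphM -E; apply: blowdown_blowup_inf.
Qed.

End Tangent.

(** * Normal crossings *)

Section NormalCrossings.
Variable R : realType.
Local Notation C := R[i].
Local Notation S := (bivar C).
Local Notation dir := (direction R).
Local Notation nc := (@normal_crossing R).
Implicit Types (f g h u v w F : S) (d : dir) (c : C).

Lemma normal_crossingP F : nc F <-> exists u v w a b,
  [/\ local_coordinates u v, unit_series w & F = w * (u ^+ a * v ^+ b)].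
Proof.
split=> -[u [v [w [a [b [uv uw E]]]]]]; exists u, v, w, a, b; split=> //.
- exact/sunitP.
- by rewrite E !smulE !spowE.
- exact/sunitP.
- by rewrite E !smulE !spowE.
Qed.

Lemma local_coordinatesC u v : local_coordinates u v -> local_coordinates v u.
Proof.
move=> [cu cv u0 v0 D]; split=> //; rewrite -oppr_eq0 opprB.
by rewrite [v 0%N 1%N * _]mulrC [v 1%N 0%N * _]mulrC.
Qed.

Lemma local_coordinates_X v : convergent v -> v 0%N 0%N = 0 -> v 0%N 1%N != 0 ->
  local_coordinates (X : S) v.
Proof.
move=> cv v0 v1; split=> //; first exact: convergent_X.
by rewrite !XE /= mul1r mul0r subr0.
Qed.

Lemma local_coordinates_Y v : convergent v -> v 0%N 0%N = 0 -> v 1%N 0%N != 0 ->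
  local_coordinates (Y : S) v.
Proof.
move=> cv v0 v1; split=> //; first exact: convergent_Y.
by rewrite !YE /= mul1r mul0r sub0r oppr_eq0.
Qed.

Lemma nc_intro u v a b w : local_coordinates u v -> unit_series w ->
  nc (w * (u ^+ a * v ^+ b)).
Proof. by move=> uv uw; apply/normal_crossingP; exists u, v, w, a, b. Qed.

Lemma nc_XY a b w : unit_series w -> nc (X ^+ a * Y ^+ b * w).
Proof.
move=> uw; rewrite mulrC; apply: nc_intro => //.
apply: local_coordinates_X; [exact: convergent_Y|by rewrite YE|].
by rewrite YE oner_neq0.
Qed.

Lemma nc_swap F : nc F -> nc (swap F).
Proof.
move=> /normal_crossingP[u [v [w [a [b [[cu cv u0 v0 D] uw ->]]]]]].
rewrite !rmorphM !rmorphXn; apply: nc_intro; last exact: unit_swap.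
apply: local_coordinatesC; split; try exact: convergent_swap; rewrite ?/swap //.
by rewrite [v 0%N 1%N * _]mulrC [v 1%N 0%N * _]mulrC.
Qed.

Lemma chart_linear c u : convergent u -> u 0%N 0%N = 0 -> exists u1 : S,
  [/\ convergent u1, chart c u = X * u1,
      u1 0%N 0%N = u 1%N 0%N + u 0%N 1%N * c & u1 0%N 1%N = u 0%N 1%N].
Proof.
move=> cu u0; exists (fun i => chart c u (i + 1)%N); split.
- exact: (@convergent_shiftX R 1 _ (convergent_chart c cu)).
- rewrite -[X]expr1; apply: fps_shift => -[|//] _; apply/funext => j.
  by rewrite chartE big_ord1 u0 mul0r.
- by rewrite chartE !big_ord_recl big_ord0 /= /bump /= addr0 !subn0 !mulr1.
- rewrite chartE !big_ord_recl big_ord0 /= /bump /= addr0.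
  by rewrite bin0n mulr0n mulr0 add0r !subnn binn expr0 mulr1.
Qed.

(** The Jacobian forbids both smooth branches from being tangent to the same direction, so at most
    one of them meets the exceptional curve at the new point, and then transversally. *)
Lemma nc_chart c F : nc F -> nc (chart c F).
Proof.
move=> /normal_crossingP[u [v [w [a [b [uv uw ->]]]]]].
have [cu cv u0 v0 D] := uv.
have [u1 [cu1 uE u10 u11]] := chart_linear c cu u0.
have [v1 [cv1 vE v10 v11]] := chart_linear c cv v0.
have ucw := unit_pull (Some c) uw; rewrite /= in ucw.
rewrite !rmorphM !rmorphXn /= uE vE.
have half p q u2 v2 : convergent u2 -> u2 0%N 0%N = 0 -> u2 0%N 1%N != 0 ->
    convergent v2 -> v2 0%N 0%N != 0 ->
    nc (chart c w * ((X * u2) ^+ p * (X * v2) ^+ q)).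
  move=> cu2 u20 u21 cv2 v20.
  have -> : chart c w * ((X * u2) ^+ p * (X * v2) ^+ q) =
      (chart c w * v2 ^+ q) * (X ^+ (p + q) * u2 ^+ p) by rewrite !exprMn exprD; ring.
  apply: nc_intro; first exact: local_coordinates_X.
  by apply: unit_seriesM => //; apply: unit_seriesX.
have [U0|U0] := eqVneq (u1 0%N 0%N) 0; have [V0|V0] := eqVneq (v1 0%N 0%N) 0.
- case/eqP: D; move: U0 V0; rewrite u10 v10.
  move/eqP; rewrite addr_eq0 => /eqP ->; move/eqP; rewrite addr_eq0 => /eqP ->.
  ring.
- apply: half => //; rewrite u11; apply: contra D => /eqP u01.
  by move: U0; rewrite u10 u01 mul0r addr0 => ->; rewrite !mul0r subr0.
- rewrite [_ * (X * v1) ^+ b]mulrC.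
  apply: half => //; rewrite v11; apply: contra D => /eqP v01.
  by move: V0; rewrite v10 v01 mul0r addr0 => ->; rewrite !mulr0 subr0.
- have -> : chart c w * ((X * u1) ^+ a * (X * v1) ^+ b) =
     X ^+ (a + b) * Y ^+ 0 * (chart c w * u1 ^+ a * v1 ^+ b).
    by rewrite !exprMn exprD; ring.
  by apply: nc_XY; do 2?[apply: unit_seriesM => //]; apply: unit_seriesX.
Qed.

Lemma chart_inf_swap F : chart_inf F = swap (chart 0 (swap F)).
Proof. by rewrite -swap_chart_inf !swapK. Qed.

Lemma nc_pull d F : nc F -> nc (pull d F).
Proof.
case: d => [c|]; first exact: nc_chart.
by rewrite /pull chart_inf_swap => /nc_swap/(nc_chart 0)/nc_swap.
Qed.

Lemma fps_expr_eq0 (r : fps C) n : r ^+ n = 0 -> r = 0.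
Proof.
elim: n => [|n IH]; first by move/eqP; rewrite oner_eq0.
by rewrite exprS => /fps_domainC[].
Qed.

(** As x divides the product, u or v vanishes on x = 0 and is x times a unit; the Jacobian then
    makes the other one transversal to that axis, and it alone can occur in G. *)
Lemma nc_divX A G : (0 < A)%N -> G 0%N <> 0 -> nc (X ^+ A * G) ->
  exists (w V : S) q, [/\ unit_series w, convergent V, V 0%N 0%N = 0, V 0%N 1%N != 0 &
    G = w * V ^+ q].
Proof.
move=> A0 G0 /normal_crossingP[u [v [w [a [b [uv uw E]]]]]].
have half p q u2 v2 : local_coordinates u2 v2 -> u2 0%N = 0 ->
    X ^+ A * G = w * (u2 ^+ p * v2 ^+ q) -> exists (w V : S) q,
    [/\ unit_series w, convergent V, V 0%N 0%N = 0, V 0%N 1%N != 0 & G = w * V ^+ q].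
  move=> [cu2 cv2 _ v20 D] u2r {}E.
  move: D; rewrite u2r fps0 mul0r subr0 mulf_eq0 negb_or => /andP[D1 D2].
  pose u3 : S := fun i => u2 (i + 1)%N.
  have u2E : u2 = X * u3.
    by rewrite -[X]expr1; apply: fps_shift => -[|//] _.
  have uu3 : unit_series u3 by split; [exact: convergent_shiftX|].
  have ww : unit_series (w * u3 ^+ p) by apply: unit_seriesM => //; apply: unit_seriesX.
  have v2r : v2 0%N <> 0.
    by move=> v2r; move/eqP: D2; rewrite v2r.
  have : X ^+ A * G = X ^+ p * (w * u3 ^+ p * v2 ^+ q).
    by rewrite E u2E exprMn; ring.
  case/varX_row0 => //.
    rewrite fpsM0; case/fps_domainC; first by move/(restr_unit (d := Some 0) ww).
    by rewrite fpsX0 => /fps_expr_eq0.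
  by move=> _ ->; exists (w * u3 ^+ p), v2, q.
have : (w * (u ^+ a * v ^+ b)) 0%N = 0.
  by rewrite -E fpsM0 fpsX0 /X /var /= expr0n (gtn_eqF A0) mul0r.
rewrite !fpsM0 !fpsX0 => /fps_domainC[/(restr_unit (d := Some 0) uw)//|].
case/fps_domainC => /fps_expr_eq0 r0; first exact: half uv r0 E.
by apply: (half b a _ _ (local_coordinatesC uv) r0); rewrite E [v ^+ b * _]mulrC.
Qed.

(** The two axes already exhaust the branches of a normal crossing, so h, which vanishes at the
    origin and is not divisible by x, can only be a multiple copy of y = 0. *)
Lemma nc_divXY A B h : (0 < A)%N -> (0 < B)%N -> h 0%N <> 0 -> h 0%N 0%N = 0 ->
  nc (X ^+ A * (Y ^+ B * h)) -> exists s j, [/\ (0 < j)%N, unit_series s & h = s * Y ^+ j].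
Proof.
move=> A0 B0 h0 h00 H.
have YB : (Y ^+ B : S) 0%N = var ^+ B by rewrite fpsX0.
have [|w [V [q [uw cV V0 V1 E]]]] := nc_divX A0 _ H.
  rewrite fpsM0 YB => /fps_domainC[|//] /(congr1 (fun u : fps C => u B)).
  by rewrite varX eqxx => /eqP; rewrite oner_eq0.
have sV : swap V 0%N = 0.
  have := congr1 (fun u : S => swap u 0%N) E.
  rewrite !rmorphM !rmorphXn /= !fpsM0 swap_Y !fpsX0.
  rewrite [X 0%N]/(var 0%N) /var /= expr0n (gtn_eqF B0) mul0r.
  by move=> /esym/fps_domainC[/(restr_unit (d := None) uw)//|/fps_expr_eq0].
pose V2 : S := fun i => swap V (i + 1)%N.
have VE : V = Y * swap V2.
  apply: (inv_inj (@swapK C)); rewrite rmorphM /= swap_Y swapK.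
  by rewrite -[X]expr1; apply: fps_shift => -[|//] _.
have cV2 : convergent (swap V2).
  apply: convergent_swap; exact: (@convergent_shiftX R 1 _ (convergent_swap cV)).
have uV2 : unit_series (swap V2) by split.
have us : unit_series (w * swap V2 ^+ q) by apply: unit_seriesM => //; apply: unit_seriesX.
have E2 : Y ^+ B * h = w * swap V2 ^+ q * Y ^+ q by rewrite E VE exprMn; ring.
have Yn n : (Y ^+ n : S) <> 0.
  move=> /(congr1 (fun u : S => u 0%N)); rewrite fpsX0 => /fps_expr_eq0.
  by move/(congr1 (fun u : fps C => u 1%N))/eqP; rewrite YE oner_eq0.
case: (ltnP B q) => Bq.
  exists (w * swap V2 ^+ q), (q - B)%N; split=> //; first by rewrite subn_gt0.
  apply: (bivar_mulI (Yn B)); rewrite E2 -{2}(subnKC (ltnW Bq)) exprD; ring.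
have : Y ^+ (B - q) * h = w * swap V2 ^+ q.
  by apply: (bivar_mulI (Yn q)); rewrite mulrA -exprD subnKC // E2 mulrC.
move/(congr1 (fun u : S => u 0%N 0%N)); rewrite bivarM00 h00 mulr0.
by case: us => _ /eqP us /esym.
Qed.

(* Which of the two axes are exceptional after a blow-up in direction [d]. *)
Definition axes_step (s : bool * bool) d : bool * bool :=
  if d is Some c then (true, s.2 && (c == 0)) else (s.1, true).

(** For a = b = 0 no power of the new exceptional equation appears. The disjunctions with [isSome d]
    add the new curve, which the multiplicity of the strict transform contributes later in
    [total_step]. *)
Lemma pull_monomial d a b : exists a' b' (u : S),
  [/\ unit_series u, pull d (X ^+ a * Y ^+ b) = X ^+ a' * Y ^+ b' * u &
      ((0 < a') || isSome d, (0 < b') || ~~ isSome d)%N = axes_step (0 < a, 0 < b)%N d].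
Proof.
case: d => [c|].
  have E : pull (Some c) (X ^+ a * Y ^+ b : S) = X ^+ (a + b) * (Y + K c) ^+ b.
    by rewrite rmorphM !rmorphXn /= chart_X chart_Y exprMn exprD mulrA.
  have [c0|c0] := eqVneq c 0.
    exists (a + b)%N, b, 1; split; first exact: unit_series1.
      have K0 : K 0 = 0 :> S by rewrite /K !rmorph0.
      by rewrite E c0 K0 addr0; apply/esym/mulr1.
    by rewrite /= c0 eqxx andbT orbT orbF.
  exists (a + b)%N, 0%N, ((Y + K c) ^+ b); split.
  - apply: unit_seriesX; split; last by rewrite !fpsD YE KE add0r.
    by apply: convergentD; [exact: convergent_Y|exact: convergent_K].
  - by rewrite E; congr (_ * _); apply/esym/mulr1.
  - by rewrite /= (negPf c0) andbF orbT.
exists a, (a + b)%N, 1; split; first exact: unit_series1.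
  by rewrite rmorphM !rmorphXn /= chart_inf_X chart_inf_Y exprMn exprD; ring.
by rewrite /= orbT orbF.
Qed.

Lemma pullM d f g : pull d (f * g) = pull d f * pull d g.
Proof. exact: rmorphM. Qed.

Lemma total_step d m a b u g g' : unit_series u -> blowup d m g g' -> (0 < m)%N ->
  exists a' b' u', [/\ unit_series u',
    pull d (X ^+ a * Y ^+ b * u * g) = X ^+ a' * Y ^+ b' * u' * g' &
    (0 < a', 0 < b')%N = axes_step (0 < a, 0 < b)%N d].
Proof.
move=> uu [[v uv gE] _] m0; have [a' [b' [w [uw E <-]]]] := pull_monomial d a b.
have ux : unit_series (w * pull d u * v).
  by do 2?[apply: unit_seriesM => //]; apply: unit_pull.
case: d E gE ux => [c|] E gE ux.
  exists (a' + m)%N, b', (w * pull (Some c) u * v); split=> //.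
    by rewrite pullM pullM E gE exprD /exc; ring.
  by rewrite addn_gt0 m0 /= !orbT orbF.
exists a', (b' + m)%N, (w * pull None u * v); split=> //.
  by rewrite pullM pullM E gE exprD /exc; ring.
by rewrite addn_gt0 m0 /= !orbT orbF.
Qed.

Lemma total_step_nc d d' m a b u g g' : unit_series u -> blowup d m g g' ->
  d' <> d -> nc (pull d' (X ^+ a * Y ^+ b * u * g)).
Proof.
move=> uu [_ B] dd; have [v uv gE] := B _ dd.
have [a' [b' [w [uw E _]]]] := pull_monomial d' a b.
rewrite pullM pullM E gE.
have ux : unit_series (w * pull d' u * v).
  by do 2?[apply: unit_seriesM => //]; apply: unit_pull.
case: (d') ux => [c|] ux /=.
  rewrite (_ : _ * _ = X ^+ (a' + m) * Y ^+ b' * (w * pull (Some c) u * v)).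
    exact: nc_XY.
  by rewrite exprD /exc; ring.
rewrite (_ : _ * _ = X ^+ a' * Y ^+ (b' + m) * (w * pull None u * v)).
  exact: nc_XY.
by rewrite exprD /exc; ring.
Qed.

End NormalCrossings.

(** * Towers of blow-ups *)

Section Towers.
Variable R : realType.
Local Notation C := R[i].
Local Notation S := (bivar C).
Local Notation dir := (direction R).
Local Notation nc := (@normal_crossing R).
Implicit Types (f g h u v w F : S) (d : dir) (ds : seq dir) (c : C).

Lemma bivarM01 f g : (f * g) 0%N 1%N = f 0%N 0%N * g 0%N 1%N + f 0%N 1%N * g 0%N 0%N.
Proof. by rewrite fpsM0 fpsM !big_ord_recl big_ord0 addr0. Qed.

Lemma bivarM10 f g : (f * g) 1%N 0%N = f 0%N 0%N * g 1%N 0%N + f 1%N 0%N * g 0%N 0%N.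
Proof. by rewrite -[f * g]swapK rmorphM; apply: (bivarM01 (swap f) (swap g)). Qed.

Lemma irreducible_smooth f : convergent f -> f 0%N 0%N = 0 ->
  (f 1%N 0%N != 0) || (f 0%N 1%N != 0) -> irreducible f.
Proof.
move=> cf f0 f1; split=> //.
- by move=> E; move: f1; rewrite E !fps0 eqxx.
- by case=> _; rewrite f0 eqxx.
move=> g h cg ch E.
have [g0|] := eqVneq (g 0%N 0%N) 0; last by left.
have [h0|] := eqVneq (h 0%N 0%N) 0; last by right.
by move: f1; rewrite E bivarM10 bivarM01 g0 h0 !mul0r !mulr0 addr0 eqxx.
Qed.

(** By [nc_divX], h is a unit times V^q with V transversal to x = 0; q = 0 would make h a unit and q
    > 1 would make it reducible. *)
Lemma nc_smooth A h : (0 < A)%N -> irreducible h -> h 0%N <> 0 -> nc (X ^+ A * h) ->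
  h 0%N 1%N != 0.
Proof.
move=> A0 ih h0 H; have h00 := irreducible00 ih.
have [w [V [[|[|q]] [uw cV V0 V1 E]]]] := nc_divX A0 h0 H.
- by case: uw => _ /eqP; case; rewrite -h00 E mulr1.
- by rewrite E expr1 bivarM01 V0 mulr0 addr0 mulf_neq0 //; case: uw.
have cwV : convergent (w * V) by apply: convergentM => //; case: uw.
have [_ _ _ /(_ _ _ cwV (convergentX q.+1 cV))] := ih.
rewrite E exprS mulrA => /(_ erefl)[[_]|[_]].
  by rewrite bivarM00 V0 mulr0 eqxx.
by rewrite bivarX00 V0 exprS mul0r eqxx.
Qed.

(** The chart at [0 : 1] leaves the coefficient of y unchanged, and off the tangent the transform
    there is y times a unit. *)
Lemma blowup_dy d m g g' : blowup d m g g' -> d <> None -> m = 1%N -> g 0%N 1%N != 0.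
Proof.
move=> [_ B] dN m1; have [v [_ v0] E] := B None (nesym dN).
have := congr1 (fun u : S => u 0%N 1%N) E.
by rewrite /pull chart_infE m1 /= /Y -rmorphXn cstM varXM /= => ->.
Qed.

Lemma blowup_dx d m g g' : blowup d m g g' -> d <> Some 0 -> m = 1%N -> g 1%N 0%N != 0.
Proof.
move=> [_ B] dN m1; have [v [_ v0] E] := B (Some 0) (nesym dN).
have := congr1 (fun u : S => u 1%N 0%N) E.
rewrite /pull -swap_chart_inf [swap _ _ _]chart_infE m1 /= expr1 varM => E1.
by have -> : g 1%N 0%N = v 0%N 0%N by exact: E1.
Qed.

(** Where g' passes, both axes are exceptional, and by [nc_divXY] a normal crossing forces g' to be
    supported on x = 0. Then x divides g, so the irreducible g is an equation of the exceptional
    curve itself and the germ below is a monomial times a unit. *)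
Lemma nc_tangent_exceptional A m u v g g' : (0 < A)%N -> irreducible g ->
  irreducible g' -> unit_series u -> unit_series v ->
  chart_inf g = Y ^+ m * (v * g') -> swap g' 0%N <> 0 ->
  nc (chart_inf (X ^+ A * u * g)) -> nc (X ^+ A * u * g).
Proof.
move=> A0 ig ig' uu uv gE rg' H.
have ux := unit_seriesM (unit_pull None uu) uv.
have sx := unit_swap ux.
have E : chart_inf (X ^+ A * u * g) =
    swap (X ^+ (A + m) * (Y ^+ A * (swap (chart_inf u * v) * swap g'))).
  rewrite !rmorphM !rmorphXn /= chart_inf_X gE swap_X swap_Y !swapK exprMn exprD.
  by ring.
have [||||s [j [j0 us sE]]] := nc_divXY (A := A + m) (B := A) (h := swap (chart_inf u * v) * swap g') _ A0.
- by rewrite addn_gt0 A0.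
- by rewrite fpsM0 => /fps_domainC[/(restr_unit (d := Some 0) sx)|].
- by rewrite bivarM00 [swap g' 0%N 0%N](irreducible00 ig') mulr0.
- by have := nc_swap H; rewrite E swapK.
have g0 : g 0%N = 0.
  have := congr1 (fun u : S => swap u) sE; rewrite !rmorphM rmorphXn /= swap_Y !swapK.
  move=> sE'; have := congr1 (fun w : S => (chart_inf u * w) 0%N) gE.
  have -> : chart_inf u * (Y ^+ m * (v * g')) = Y ^+ m * (chart_inf u * v * g') by ring.
  rewrite sE' !fpsM0 !fpsX0 [X 0%N]/var /= expr0n (gtn_eqF j0) mulr0 mulr0.
  case/fps_domainC; first by move/(restr_unit (d := Some 0) (unit_pull None uu)).
  by rewrite /chart_inf expr0 mul1r.
pose g1 : S := fun i => g (i + 1)%N.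
have g1E : g = X * g1 by rewrite -[X]expr1; apply: fps_shift => -[|//] _.
have [cg _ _ /(_ X g1 (@convergent_X R) (@convergent_shiftX R 1 _ cg) g1E)] := ig.
case=> [[_]|ug1]; first by rewrite XE /= eqxx.
rewrite (_ : _ * _ = X ^+ A.+1 * Y ^+ 0 * (u * g1)); first exact/nc_XY/unit_seriesM.
by rewrite g1E exprS; ring.
Qed.

(** The two booleans differ exactly when a single exceptional curve passes through the centre, that
    is at a free point. The cases are whether the tangent of g leaves or follows that curve. *)
Lemma nc_of_blowup a b u g : irreducible g -> unit_series u ->
  (0 < a)%N != (0 < b)%N -> (forall d, nc (pull d (X ^+ a * Y ^+ b * u * g))) ->
  nc (X ^+ a * Y ^+ b * u * g).
Proof.
move=> ig uu ab H; have [cg _ _ _] := ig; have g00 := irreducible00 ig.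
have [t [m [g' [e [m0 ig' B rg' e0]]]]] := blowup_irreducible ig.
have rg'0 : restr t g' <> 0.
  rewrite rg' => /(congr1 (fun u : fps C => u m)); rewrite varXM leqnn subnn fps0.
  exact/eqP.
have g'0 := irreducible00 ig'.
have m1 : restr t g' 1%N != 0 -> m = 1%N.
  by rewrite rg' varXM; case: (m) m0 => [|[|k]] //=; rewrite eqxx.
have [a' [b' [u' [uu' E]]]] := total_step a b uu B m0.
have XcaseF : b = 0%N -> g 0%N 1%N != 0 -> nc (X ^+ a * Y ^+ b * u * g).
  move=> -> g1; rewrite (_ : _ * g = u * (X ^+ a * g ^+ 1)); last by ring.
  exact/nc_intro/uu/local_coordinates_X.
have YcaseF : a = 0%N -> g 1%N 0%N != 0 -> nc (X ^+ a * Y ^+ b * u * g).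
  move=> -> g1; rewrite (_ : _ * g = u * (Y ^+ b * g ^+ 1)); last by ring.
  exact/nc_intro/uu/local_coordinates_Y.
have iug' := irreducible_unitM uu' ig'.
case: t B rg' rg'0 m1 E => [c|] B rg' rg'0 m1 E /= [].
- move=> a'0 b'E; have [b'0|b'0] := posnP b'.
    (* Only the new exceptional curve passes here. The strict transform is transversal to it, so
       their intersection number m is 1; g is then smooth and, by its tangent direction, transversal
       to the old curve. *)
    have m1' : m = 1%N.
      apply: m1; have : (u' * g') 0%N 1%N != 0.
        apply: (nc_smooth a'0) => //.
          by rewrite fpsM0 => /fps_domainC[/(restr_unit (d := Some 0) uu')|].
        by have := H (Some c); rewrite E b'0 expr0 mulr1 mulrA.
      rewrite bivarM01 g'0 mulr0 addr0; apply: contra => /eqP g'1.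
      by rewrite [g' 0%N 1%N]g'1 mulr0.
    have [b0|b0] := posnP b; first by apply: XcaseF b0 _; apply: blowup_dy B _ m1'.
    apply: YcaseF; first by move: ab; rewrite b0; case: (a).
    apply: blowup_dx B _ m1' => -[c0].
    by move: b'E; rewrite b'0 b0 c0 eqxx.
  (* Here g is tangent to the old exceptional curve y = 0; exchanging the coordinates turns this
     direction into [0 : 1]. *)
  move: b'E; rewrite b'0 => /esym/andP[b0 /eqP c0].
  have a0 : a = 0%N by move: ab; rewrite b0; case: (a).
  have [[v uv gE] _] := B.
  have gE' : chart_inf (swap g) = Y ^+ m * (swap v * swap g').
    have gE0 : chart 0 g = X ^+ m * (v * g') by rewrite -c0; exact: gE.
    by rewrite chart_inf_swap [swap (swap g)]swapK gE0 !rmorphM rmorphXn /= swap_X.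
  have FE : X ^+ a * Y ^+ b * u * g = swap (X ^+ b * swap u * swap g).
    by rewrite !rmorphM rmorphXn /= swap_X !swapK a0 expr0 mul1r.
  rewrite FE; apply/nc_swap/(nc_tangent_exceptional b0 _ _ _ _ gE').
  + exact: irreducible_swap.
  + exact: irreducible_swap.
  + exact: unit_swap.
  + exact: unit_swap.
  + exact: rg'0.
  + rewrite chart_inf_swap; apply: nc_swap; rewrite -FE.
    by have := H (Some c); rewrite c0.
- move=> a'E b'0; have [a'0|a'0] := posnP a'.
    have a0 : a = 0%N by move: a'E; rewrite a'0; case: (a).
    have m1' : m = 1%N.
      apply: m1; have : swap (u' * g') 0%N 1%N != 0.
        apply: (nc_smooth b'0); first exact: irreducible_swap.
          by rewrite rmorphM fpsM0 => /fps_domainC[/(restr_unit (d := None) uu')|].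
        have := nc_swap (H None); rewrite E a'0 expr0 mul1r -mulrA.
        by rewrite rmorphM rmorphXn /= swap_Y.
      rewrite rmorphM /= bivarM01 [swap g' 0%N 0%N]g'0 mulr0 addr0.
      by apply: contra => /eqP g'1; rewrite [swap g' 0%N 1%N]g'1 mulr0.
    by apply: YcaseF a0 _; apply: blowup_dx B _ m1'.
  have a0 : (0 < a)%N by rewrite -a'E.
  have b0 : b = 0%N by move: ab; rewrite a0; case: (b).
  have [[v uv gE] _] := B.
  have FE : X ^+ a * Y ^+ b * u * g = X ^+ a * u * g by rewrite b0 expr0 mulr1.
  rewrite FE; apply: (nc_tangent_exceptional a0 ig ig' uu uv gE rg'0).
  by rewrite -FE; apply: (H None).
Qed.

Definition axes ds := foldl (@axes_step R) (false, false) ds.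

Lemma total_transformE f ds : total_transform f ds = foldl (fun g d => pull d g) f ds.
Proof. by elim: ds f => //= d ds IH f; rewrite IH pullbackE. Qed.

Lemma total_transform_rcons f ds d :
  total_transform f (rcons ds d) = pull d (total_transform f ds).
Proof. by rewrite !total_transformE foldl_rcons. Qed.

(** By [total_step_nc], a direction other than the tangent gives a normal crossing, so the path
    follows the strict transforms. *)
Lemma total_transform_decomposition f ds : irreducible f ->
  (forall k, (k <= size ds)%N -> ~ nc (total_transform f (take k ds))) ->
  exists a b u g, [/\ irreducible g, unit_series u,
    total_transform f ds = X ^+ a * Y ^+ b * u * g & (0 < a, 0 < b)%N = axes ds].
Proof.
move=> irf; elim/last_ind: ds => [|ds d IH] H.
  exists 0%N, 0%N, 1, f; split=> //; first exact: unit_series1.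
  by rewrite !expr0 !mul1r.
have [k kds|a [b [u [g [ig uu E ax]]]]] := IH.
  have := H k; rewrite size_rcons -cats1 takel_cat //; apply; exact: leqW.
have [t [m [g' [e [m0 ig' B _ _]]]]] := blowup_irreducible ig.
have [td|/eqP td] := eqVneq d t; last first.
  have := H (size (rcons ds d)) (leqnn _); rewrite take_size total_transform_rcons E.
  by case; apply: total_step_nc B td.
subst t; have [a' [b' [u' [uu' E' ax']]]] := total_step a b uu B m0.
exists a', b', u', g'; split=> //; first by rewrite total_transform_rcons E.
by rewrite ax' ax /axes foldl_rcons.
Qed.

Lemma last_point_satellite f ds : irreducible f -> (0 < size ds)%N ->
  (forall k, (k <= size ds)%N -> ~ nc (total_transform f (take k ds))) ->
  (forall d, nc (total_transform f (rcons ds d))) -> axes ds = (true, true).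
Proof.
move=> irf; case/lastP: ds => // ds d _ H H'.
have [a [b [u [g [ig uu E ax]]]]] := total_transform_decomposition irf H.
(* After a blow-up at least one axis is exceptional; exactly one is ruled out by [nc_of_blowup]. *)
have [//|ab] : (0 < a)%N && (0 < b)%N \/ (0 < a)%N != (0 < b)%N.
- move: ax; rewrite /axes foldl_rcons.
  by case: (d) => [c|] /= [-> ->] /=; [case: (_ && _)|case: (_.1)]; [left|right|left|right].
- by rewrite -ax => /andP[-> ->].
have := H _ (leqnn _); rewrite take_size E; case; apply: nc_of_blowup => // d'.
by rewrite -E -total_transform_rcons.
Qed.

Fixpoint tower f ds g : Prop :=
  if ds is d :: ds' then
    exists m f1, [/\ (0 < m)%N, blowup d m f f1 & tower f1 ds' g]
  else f = g.

Lemma tower_exists ds g : irreducible g -> off_axes g ->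
  exists f, [/\ irreducible f, off_axes f & tower f ds g].
Proof.
move=> ig tg; elim: ds => [|d ds [f [irf tf tw]]]; first by exists g.
have [m [f0 [m0 if0 tf0 B]]] := blowdown_irreducible d irf tf.
by exists f0; split=> //; exists m, f.
Qed.

(** The monomial and the unit in front of f make the induction possible: each step moves a new
    exceptional component into them. *)
Lemma tower_total ds f g a b u : tower f ds g -> unit_series u ->
  (exists a' b' u', [/\ unit_series u',
    total_transform (X ^+ a * Y ^+ b * u * f) ds = X ^+ a' * Y ^+ b' * u' * g &
    (0 < a', 0 < b')%N = foldl (@axes_step R) (0 < a, 0 < b)%N ds]) /\
  (forall k d, (k < size ds)%N -> d <> nth None ds k ->
    nc (total_transform (X ^+ a * Y ^+ b * u * f) (rcons (take k ds) d))).
Proof.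
elim: ds f a b u => [|d0 ds IH] f a b u /=.
  by move=> -> uu; split=> //; exists a, b, u.
move=> [m [f1 [m0 B tw]]] uu.
have [a1 [b1 [u1 [uu1 E1 ax1]]]] := total_step a b uu B m0.
have [H1 H2] := IH _ a1 b1 u1 tw uu1.
rewrite pullbackE E1 -ax1; split=> // -[|k] d kd dk.
  by rewrite /= pullbackE; apply: total_step_nc B dk.
by rewrite /= pullbackE E1; apply: H2.
Qed.

Lemma diagonal_blowup : blowup (Some 1) 1 (Y - X : S) Y.
Proof.
have wY : weierstrass 1 (Y : S).
  split; [exact: convergent_Y|by []|].
  by move=> i j _; rewrite expr1 subrr !fps0.
have := blowdown_blowup 1 wY; rewrite /blowdown big_ord_recl big_ord0 addr0 expr1.
have -> : ycoef 0 (Y : S) = 0.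
  by apply/funext => i; rewrite /ycoef YE andbF rmorph0.
by rewrite !mul0r addr0 /K !rmorph1 mul1r.
Qed.

Lemma nc_diagonal a b u d : unit_series u -> nc (pull d (X ^+ a * Y ^+ b * u * (Y - X))).
Proof.
move=> uu; have [->|/eqP d1] := eqVneq d (Some 1); last exact: total_step_nc diagonal_blowup d1.
have [a' [b' [u' [uu' -> _]]]] := total_step a b uu diagonal_blowup isT.
rewrite (_ : _ * _ = X ^+ a' * Y ^+ b'.+1 * u'); first exact: nc_XY.
by rewrite exprS; ring.
Qed.

(** By [nc_divXY] the third branch y = x would have to be the axis y = 0, but it does not vanish
    there. *)
Lemma not_nc_diagonal a b u : unit_series u -> (0 < a)%N -> (0 < b)%N ->
  ~ nc (X ^+ a * Y ^+ b * u * (Y - X)).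
Proof.
move=> uu a0 b0; rewrite -!mulrA => H.
have var0 : (var : fps C) <> 0.
  by move/(congr1 (fun u : fps C => u 1%N))/eqP; rewrite /var /= oner_eq0.
have [||s [j [j0 us E]]] := nc_divXY a0 b0 _ _ H.
- rewrite fpsM0 => /fps_domainC[/(restr_unit (d := Some 0) uu)//|].
  by rewrite fpsD fpsN [X 0%N]/var /= subr0 => /var0.
- by rewrite bivarM00 !fpsD !fpsN XE YE subr0 mulr0.
have := congr1 (fun w : S => swap w 0%N) E.
rewrite !rmorphM rmorphB rmorphXn /= swap_X swap_Y !fpsM0 fpsX0 fpsD fpsN.
rewrite [X 0%N]/var /= expr0n (gtn_eqF j0) mulr0 sub0r mulrN => /eqP.
rewrite oppr_eq0 => /eqP/fps_domainC[/(restr_unit (d := None) uu)//|/var0//].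
Qed.

Lemma branch_exists ds : axes ds = (true, true) -> exists f,
  [/\ irreducible f,
      forall k, (k <= size ds)%N -> ~ nc (total_transform f (take k ds)),
      forall k d, (k < size ds)%N -> d <> nth None ds k ->
        nc (total_transform f (rcons (take k ds) d)) &
      forall d, nc (total_transform f (rcons ds d))].
Proof.
move=> ax; have cg : convergent (Y - X : S).
  by apply: convergentD; [exact: convergent_Y|exact/convergentN/convergent_X].
have ig : irreducible (Y - X : S).
  apply: irreducible_smooth => //; first by rewrite !fpsD !fpsN XE YE subr0.
  by rewrite !fpsD !fpsN !XE !YE /= subr0 oner_neq0 orbT.
have tg : off_axes (Y - X : S).
  split=> /(congr1 (fun u : fps C => u 1%N))/eqP; rewrite /restr /= ?/swap !fpsD !fpsN !XE !YE /=.
    by rewrite subr0 oner_eq0.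
  by rewrite sub0r oppr_eq0 oner_eq0.
have [f [irf _ tw]] := tower_exists ds ig tg; exists f.
have [[a [b [u [uu E ax']]]] H] := tower_total 0 0 tw (@unit_series1 R).
have f1 : X ^+ 0 * Y ^+ 0 * 1 * f = f by rewrite !expr0 !mul1r.
rewrite f1 in E H; have [a0 b0] : (0 < a)%N /\ (0 < b)%N.
  by move: ax'; rewrite -/(axes ds) ax => -[-> ->].
split=> // [k kd|d]; last by rewrite total_transform_rcons E; apply: nc_diagonal.
(* Normal crossings persist under pullback, so one at an intermediate point would give one at the
   last point. *)
move=> Hk; apply: (not_nc_diagonal uu a0 b0); rewrite -E -(cat_take_drop k ds).
move: Hk; rewrite !total_transformE foldl_cat.
elim: (drop k ds) (foldl _ f (take k ds)) => //= d s IH F HF.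
by apply: IH; apply: nc_pull.
Qed.

End Towers.

(** * Proximity *)

Section Proximity.
Variable R : realType.
Local Notation C := R[i].
Local Notation S := (bivar C).
Local Notation dir := (direction R).
Implicit Types (f g h : S) (d : dir) (ds : seq dir) (c : C).

Lemma row0_divX g : g 0%N = 0 -> g = X * (fun i => g (i + 1)%N : fps C).
Proof. by move=> g0; rewrite -[X]expr1; apply: fps_shift => -[|//] _. Qed.

Lemma restr_ndivides d g : convergent g -> ~ sdivides (exceptional_eq d) g -> restr d g <> 0.
Proof.
move=> cg nd g0; apply: nd; rewrite exceptional_eqE; case: d g0 => [c|] /= g0.
  exists (fun i => g (i + 1)%N); split; first exact: (@convergent_shiftX R 1).
  by rewrite smulE; apply: row0_divX.
pose h : S := fun i => swap g (i + 1)%N.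
exists (swap h); split.
  by apply: convergent_swap; apply: (@convergent_shiftX R 1 _ (convergent_swap cg)).
rewrite smulE -swap_X -rmorphM; apply: (inv_inj (@swapK C)); rewrite [RHS]swapK.
exact: row0_divX.
Qed.

Lemma is_strict_unique d m g h g' : pull d g = exc d ^+ m * h -> restr d h <> 0 ->
  is_strict d g g' -> g' = h.
Proof.
move=> gE rh [l [cg' E nd]].
have E' : exc d ^+ m * h = exc d ^+ l * g'.
  by rewrite -gE -pullbackE E smulE spowE exceptional_eqE.
by have [_ ->] := exc_cancel rh (restr_ndivides cg' nd) E'.
Qed.

Lemma is_strict_intro d m g h : pull d g = exc d ^+ m * h -> restr d h <> 0 ->
  convergent h -> is_strict d g h.
Proof.
move=> gE rh ch; exists m; split=> //; first by rewrite smulE spowE exceptional_eqE pullbackE.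
move=> [k [_]]; rewrite smulE exceptional_eqE => hE; apply: rh; rewrite hE.
case: (d) => [c|]; rewrite /restr ?rmorphM fpsM0 /= ?swap_Y [X 0%N]/var /=.
  exact: mul0r.
exact: mul0r.
Qed.

Lemma is_strict_along_unit r g g' : g 0%N 0%N != 0 -> is_strict_along r g g' ->
  g' 0%N 0%N != 0.
Proof.
elim: r g => [g g0 -> //|d r IH g g0 [h [[m [_ E _]] /IH]]]; apply.
apply: contra g0 => /eqP h0; rewrite -(pull00 d) -pullbackE E smulE spowE.
by rewrite bivarM00 h0 mulr0.
Qed.

(* The direction which a blow-up must take to stay on the exceptional curve
   created by a blow-up in direction [d]. *)
Definition follow d : dir := if d is Some _ then None else Some 0.

Lemma follow_neq d : follow d <> d. Proof. by case: d. Qed.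

Let var0 : (var : fps C) <> 0.
Proof. by move/(congr1 (fun u : fps C => u 1%N))/eqP; rewrite /var /= oner_eq0. Qed.
Let one0 : (1 : fps C) <> 0. Proof. by move/eqP; rewrite oner_eq0. Qed.

Lemma exc_follow d : [/\ pull (follow d) (exc d) = exc (follow d) ^+ 1 * exc d,
  restr (follow d) (exc d) <> 0 & exc d 0%N 0%N = 0].
Proof.
case: d => [c|]; split.
- by rewrite /= chart_inf_X mulrC.
- by rewrite /= swap_X.
- exact: XE.
- by rewrite /= chart_Y /K !rmorph0 addr0.
- exact: var0.
- exact: YE.
Qed.

Lemma exc_leave d d' g : d' <> follow d -> is_strict d' (exc d) g -> g 0%N 0%N != 0.
Proof.
move=> dd; case: d dd => [c|] dd; case: d' dd => [c'|] dd // H.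
- rewrite (is_strict_unique (m := 1) (h := 1) _ _ H) ?fps1 ?oner_neq0 //.
  by rewrite /= chart_X mulr1.
- rewrite (is_strict_unique (m := 1) (h := Y + K c') _ _ H).
  + rewrite !fpsD YE KE add0r; apply/eqP => c0; apply: dd.
    by rewrite c0.
  + by rewrite /= chart_Y.
  + move/(congr1 (fun u : fps C => u 1%N))/eqP.
    by rewrite /= !fpsD YE KE addr0 oner_eq0.
- rewrite (is_strict_unique (m := 1) (h := 1) _ _ H) ?fps1 ?oner_neq0 //.
  by rewrite /= chart_inf_Y mulr1.
- by rewrite /restr rmorph1; exact: one0.
Qed.

(** In direction [follow d] the strict transform of the exceptional curve has the same equation
    [exc d] in the new coordinates, so the same direction must be repeated; any other one leaves the
    curve for good. *)
Lemma is_strict_along_exc d r :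
  (exists2 g, is_strict_along r (exc d) g & g 0%N 0%N = 0) <-> all (pred1 (follow d)) r.
Proof.
have [E r0 e0] := exc_follow d.
elim: r => [|d' r IH] /=.
  by split=> // _; exists (exc d).
split=> [[g [h [Hh Hg]] g0]|/andP[/eqP -> /IH[g Hg g0]]].
  have [dd|/eqP dd] := eqVneq d' (follow d).
    subst d'; apply/IH; exists g => //.
    by rewrite -(is_strict_unique E r0 Hh).
  by have := is_strict_along_unit (exc_leave dd Hh) Hg; rewrite g0 eqxx.
exists g => //; exists (exc d); split=> //.
exact: is_strict_intro E r0 (convergent_exc d).
Qed.

Section Indices.
Variable ds : seq dir.

(* In terms of the directions [ds] leading to the last point, the [j]-th point
   is proximate to the [i]-th. *)
Definition prox j i := (i < j)%N /\
  forall l, (i < l < j)%N -> nth None ds l = follow (nth None ds i).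

Lemma prox_self i : prox i.+1 i.
Proof. by split=> // l; rewrite ltnS; case: ltnP => // il; rewrite leqNgt il. Qed.

Lemma proxS j i : prox j.+1 i <->
  i = j \/ (prox j i /\ nth None ds j = follow (nth None ds i)).
Proof.
split=> [[ij H]|[->|[[ij H] E]]].
- move: ij; rewrite ltnS leq_eqVlt => /orP[/eqP|ij]; [by left|right].
  split; last by apply: H; rewrite ij ltnSn.
  by split=> // l /andP[il lj]; apply: H; rewrite il ltnW.
- exact: prox_self.
- split=> [|l]; first by rewrite ltnW.
  rewrite ltnS [(l <= j)%N]leq_eqVlt => /andP[il /orP[/eqP ->//|lj]].
  by apply: H; rewrite il.
Qed.

Lemma prox_le j k i : prox k i -> (i < j <= k)%N -> prox j i.
Proof.
move=> [ik H] /andP[ij jk]; split=> // l /andP[il lj]; apply: H.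
by rewrite il (leq_trans lj).
Qed.

(** If i < i', the directions at i' and i' + 1 are both [follow] of the one at i, while the second
    is also [follow] of the first; but [follow] has no fixed point. *)
Lemma prox_uniq j i i' : prox j i -> prox j i' -> (i.+1 < j)%N -> (i'.+1 < j)%N -> i = i'.
Proof.
wlog ii : i i' / (i <= i')%N.
  by move=> H p p' ij ij'; case: (leqP i i') => [|/ltnW] ?; [|apply/esym]; apply: H.
move=> [_ H] [_ H'] ij ij'; move: ii; rewrite leq_eqVlt => /orP[/eqP //|ii].
have E := H i'; rewrite ii (ltnW ij') in E.
have E1 := H i'.+1; rewrite ltnS (ltnW ii) ij' /= in E1.
have E2 := H' i'.+1; rewrite ltnSn ij' /= in E2.
by case: (@follow_neq (follow (nth None ds i))); rewrite -{1}E // -E2 // E1.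
Qed.

(** Every point is proximate to its immediate predecessor, so a satellite is a point proximate to an
    earlier one as well. *)
Definition satellite j := exists2 i, (i.+1 < j)%N & prox j i.

Lemma proximate_take j p : (j <= size ds)%N ->
  (proximate (take j ds) p <-> exists2 i, prox j i & p = take i ds).
Proof.
move=> jds; split=> [[d [r [g [E Hg g0]]]]|[i [ij H] ->]].
  rewrite exceptional_eqE in Hg.
  have /allP Hr : all (pred1 (follow d)) r by apply/is_strict_along_exc; exists g.
  have sz : j = (size p + (size r).+1)%N by rewrite -(size_takel jds) E size_cat.
  have nthE l : (l < j)%N -> nth None ds l = nth None (p ++ d :: r) l.
    by move=> lj; rewrite -E nth_take.
  have pj : (size p < j)%N by rewrite sz addnS ltnS leq_addr.
  exists (size p); last first.
    by rewrite -(take_takel ds (ltnW pj)) E take_size_cat.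
  split=> // l /andP[pl lj]; rewrite !nthE // !nth_cat ltnn subnn ltnNge (ltnW pl) /=.
  rewrite -(subnSK pl) /=; apply/eqP/Hr/mem_nth.
  by rewrite ltn_subLR // addSnnS -sz.
exists (nth None ds i), (drop i.+1 (take j ds)).
have tE : take j ds = take i ds ++ nth None ds i :: drop i.+1 (take j ds).
  rewrite -{1}(cat_take_drop i (take j ds)) take_takel ?(ltnW ij) //.
  by rewrite (drop_nth None) ?size_takel // nth_take.
have [|g Hg g0] := (is_strict_along_exc (nth None ds i) (drop i.+1 (take j ds))).2.
  apply/(all_nthP None) => l; rewrite size_drop size_takel // ltn_subRL => lj.
  by rewrite nth_drop nth_take //; apply/eqP/H; rewrite lj andbT addSn ltnS leq_addr.
by exists g; rewrite exceptional_eqE.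
Qed.

Lemma take_inj_size i j : (i <= size ds)%N -> (j <= size ds)%N ->
  take i ds = take j ds -> i = j.
Proof. by move=> ids jds /(congr1 size); rewrite !size_takel. Qed.

Lemma proximate_takeE j i : (j <= size ds)%N -> (i <= size ds)%N ->
  (proximate (take j ds) (take i ds) <-> prox j i).
Proof.
move=> jds ids; rewrite proximate_take //; split=> [[i' p E]|p]; last by exists i.
have i'ds : (i' <= size ds)%N by case: p => /ltnW/leq_trans + _; apply.
by rewrite (take_inj_size ids i'ds E).
Qed.

Lemma is_free_take j : (0 < j <= size ds)%N -> (is_free (take j ds) <-> ~ satellite j).
Proof.
case: j => // j jds; have jd : (j <= size ds)%N := ltnW jds.
split=> [[_ [p [_ U]]] [i ij pi]|ns].
  have E i' : prox j.+1 i' -> p = take i' ds.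
    by move=> pi'; apply: U; rewrite proximate_take //; exists i'.
  have ids : (i <= size ds)%N by rewrite (leq_trans _ jd) // ltnW.
  have := E j (prox_self j); rewrite (E i pi) => /(take_inj_size ids jd) ij'.
  by rewrite ij' ltnn in ij.
split; first by move/(congr1 size); rewrite size_takel.
exists (take j ds); split=> [|p]; first by rewrite proximate_take //; exists j => //; exact: prox_self.
rewrite proximate_take // => -[i pi ->]; congr take.
case: (ltngtP i j) pi => // [ij|ji] pi; first by case: ns; exists i.
by case: pi; rewrite ltnS leqNgt ji.
Qed.

(** At each point proximate to the i-th, the curve created there still has the equation [exc] of the
    i-th direction, so the type of that direction tells which axis it is. *)
Lemma axes_take j : (j <= size ds)%N ->
  ((axes (take j ds)).1 <-> exists2 i, prox j i & isSome (nth None ds i)) /\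
  ((axes (take j ds)).2 <-> exists2 i, prox j i & ~~ isSome (nth None ds i)).
Proof.
elim: j => [|j IH] jds.
  by rewrite take0; split; split=> // -[i []].
have [IH1 IH2] := IH (ltnW jds).
rewrite (take_nth None) // /axes foldl_rcons -/(axes _).
case E: (nth None ds j) => [c|] /=; split.
- by split=> // _; exists j; [exact: prox_self|rewrite E].
- split=> [/andP[/IH2[i pi Ni] /eqP c0]|[i /proxS[->|[pi Ei]] Ni]].
  + exists i => //; apply/proxS; right; split=> //.
    by rewrite E c0; case: (nth None ds i) Ni.
  + by rewrite E in Ni.
  + apply/andP; split; first by apply/IH2; exists i.
    by move: Ei Ni; rewrite E; case: (nth None ds i) => [//|[->]].
- split=> [/IH1[i pi Ni]|[i /proxS[->|[pi Ei]] Ni]].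
  + exists i => //; apply/proxS; right; split=> //.
    by rewrite E; case: (nth None ds i) Ni.
  + by rewrite E in Ni.
  + by apply/IH1; exists i.
- by split=> // _; exists j; [exact: prox_self|rewrite E].
Qed.

(** If the last point is proximate to the i-th and to its predecessor, the direction at the
    predecessor is [follow] of the i-th, hence of the other type: the two curves are different
    axes. *)
Lemma axes_satellite : axes ds = (true, true) <-> satellite (size ds).
Proof.
have [] := axes_take (leqnn (size ds)); rewrite take_size; case: (axes ds) => a b /= H1 H2.
split=> [[aT bT]|[i is_ pi]].
  move: H1 H2; rewrite aT bT => -[/(_ isT)[i pi Ni] _] [/(_ isT)[j pj Nj] _].
  have [iS|iS] := ltnP i.+1 (size ds); first by exists i.
  have [jS|jS] := ltnP j.+1 (size ds); first by exists j.
  have [[i1 _] [j1 _]] := (pi, pj).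
  have ij : i = j by apply/eqP; rewrite -eqSS eqn_leq (leq_trans i1 jS) (leq_trans j1 iS).
  by rewrite ij (negPf Nj) in Ni.
have [k kE] : exists k, size ds = k.+1 by case: (size ds) is_ => // k; exists k.
have [_ Hf] := pi; have := Hf k; rewrite kE ltnSn andbT.
rewrite -ltnS -kE is_ => /(_ isT) Ek.
have pk : prox (size ds) k by rewrite kE; exact: prox_self.
have [SI|SI] := boolP (isSome (nth None ds i)).
  have -> : a by apply/H1; exists i.
  by have -> : b by apply/H2; exists k => //; rewrite Ek; case: (nth None ds i) SI.
have -> : b by apply/H2; exists i.
by have -> : a by apply/H1; exists k => //; rewrite Ek; case: (nth None ds i) SI.
Qed.

End Indices.
End Proximity.

(** * Resolutions and admissible decorations *)

Section Resolution.
Variable R : realType.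
Local Notation C := R[i].
Local Notation S := (bivar C).
Local Notation dir := (direction R).
Local Notation nc := (@normal_crossing R).
Implicit Types (f : S) (ds : seq dir).

Definition points ds : seq (point R) := mkseq (fun i => take i ds) (size ds).+1.

Lemma nth_points ds i : (i <= size ds)%N -> nth [::] (points ds) i = take i ds.
Proof. by move=> ids; rewrite nth_mkseq. Qed.

Lemma mem_points ds i q : (i <= (size ds).+1)%N -> q \in take i (points ds) ->
  exists2 k, (k < i)%N & q = take k ds.
Proof.
move=> ids; rewrite /points /mkseq -map_take take_iota (minn_idPl ids).
by case/mapP => k; rewrite mem_iota => /andP[_ ki] ->; exists k.
Qed.

Lemma mem_take_points ds i k : (k < i <= (size ds).+1)%N ->
  take k ds \in take i (points ds).
Proof.
move=> /andP[ki ids]; rewrite /points /mkseq -map_take take_iota (minn_idPl ids).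
by apply: map_f; rewrite mem_iota.
Qed.

(** Each centre lies over the preceding one: otherwise it would already be a point without normal
    crossing on the previous model, and uniqueness would identify it with the preceding centre. *)
Lemma resolution_points f (P : seq (point R)) : (0 < size P)%N ->
  is_minimal_embedded_resolution f P -> exists2 ds, P = points ds &
    (forall k, (k <= size ds)%N -> ~ nc (total_transform f (take k ds))) /\
    (forall d, nc (total_transform f (rcons ds d))).
Proof.
move=> P0 [H1 H2].
have nth_mem l k : (l < k)%N -> (k <= size P)%N -> nth [::] P l \in take k P.
  by move=> lk kP; rewrite -(nth_take _ lk) mem_nth // size_takel.
have chain i : (i < size P)%N -> size (nth [::] P i) = i /\
    forall k, (k <= i)%N -> take k (nth [::] P i) = nth [::] P k.
  elim/ltn_ind: i => -[|i] IH iP.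
    have [[[_ on] _] _] := H1 0%N iP.
    have s0 : size (nth [::] P 0) = 0%N.
      by apply/eqP; rewrite -leqn0 leqNgt; apply/negP => /on; rewrite !take0.
    by split=> // k; rewrite leqn0 => /eqP ->; rewrite -{1}s0 take_oversize ?s0 ?take_size.
  move: (H1 _ iP); move Eq: (nth [::] P i.+1) => q [[[qP on] nq] _].
  have iP' := ltnW iP; have [si ti] := IH i (ltnSn i) iP'.
  have memP k p : (k < size P)%N -> p \in take k P -> exists2 l, (l < k)%N & p = nth [::] P l.
    move=> kP /(nthP [::])[l]; rewrite size_takel ?(ltnW kP) // => lk <-.
    by exists l => //; rewrite nth_take.
  have [k kq kE] : exists2 k, (k < size q)%N & take k q = nth [::] P i.
    apply: contrapT => nk.
    have qPi : nth [::] P i = q.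
      have [_ U] := H1 i iP'; apply: U; split=> //; split.
        by apply: contra qP => /(memP _ _ iP')[l li ->]; apply: nth_mem (leqW li) iP'.
      move=> k kq; have [l li kE] := memP _ _ iP (on k kq).
      move: li; rewrite ltnS leq_eqVlt => /orP[/eqP li|li].
        by case: nk; exists k => //; rewrite kE li.
      by rewrite kE; apply: nth_mem li (ltnW iP').
    by move/negP: qP; apply; rewrite -qPi; apply: nth_mem.
  have ki : k = i by rewrite -si -kE size_takel // ltnW.
  subst k; have sq : size q = i.+1.
    apply/eqP; rewrite eqn_leq kq andbT leqNgt; apply/negP => iq.
    have [l li E] := memP _ _ iP (on _ iq).
    have := congr1 size E; rewrite size_takel ?(ltnW iq) // (IH l li (ltn_trans li iP)).1.
    by move=> E'; rewrite -E' ltnn in li.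
  split=> // k; rewrite leq_eqVlt => /orP[/eqP ->|ki]; first by rewrite take_oversize ?sq.
  by rewrite -(take_takel q (ki : (k <= i)%N)) kE ti.
pose ds := nth [::] P (size P).-1; have lP : ((size P).-1 < size P)%N by rewrite prednK.
have [sd td] := chain _ lP.
have PE : P = points ds.
  apply: (@eq_from_nth _ [::]); first by rewrite size_mkseq sd prednK.
  move=> i iP; have isz : (i <= (size P).-1)%N by rewrite -ltnS prednK.
  by rewrite nth_points ?sd // td.
exists ds => //; split=> [k kd|d].
  have kP : (k < size P)%N by rewrite PE size_mkseq.
  by have [[_]] := H1 k kP; rewrite {1}PE nth_points.
apply: H2; rewrite PE; have szP := size_mkseq (fun i => take i ds) (size ds).+1.
have tk : take (size ds).+1 (points ds) = points ds by rewrite take_oversize ?szP.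
split=> [|k]; last first.
  rewrite size_rcons ltnS => kd; rewrite -cats1 takel_cat // -tk.
  by apply: mem_take_points; rewrite ltnS kd leqnn.
rewrite -tk; apply/negP => /(mem_points (leqnn _))[k kd] /(congr1 size).
by rewrite size_rcons size_takel -1?ltnS // => E; rewrite -E ltnn in kd.
Qed.

Lemma points_resolution f ds :
  (forall k, (k <= size ds)%N -> ~ nc (total_transform f (take k ds))) ->
  (forall k d, (k < size ds)%N -> d <> nth None ds k ->
    nc (total_transform f (rcons (take k ds) d))) ->
  (forall d, nc (total_transform f (rcons ds d))) ->
  is_minimal_embedded_resolution f (points ds).
Proof.
move=> Hnot Hoff Hend; have szP := size_mkseq (fun i => take i ds) (size ds).+1.
have tk : take (size ds).+1 (points ds) = points ds by rewrite take_oversize ?szP.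
(* The centre below such a point is on the path, and leaving the path gives a normal crossing. So
   the point is on the path and, not being blown up yet, is the next one. *)
have key i q : (i <= (size ds).+1)%N -> on_model (take i (points ds)) q ->
    ~ nc (total_transform f q) -> (i <= size ds)%N /\ q = take i ds.
  move=> ids [qP on] nq.
  case: (lastP q) qP on nq => [|p d] qP on nq.
    case: i ids qP {on} => [|i] ids qP; first by rewrite take0.
    by case/negP: qP; rewrite -(take0 ds); apply: mem_take_points.
  have [|k ki pE] := mem_points ids (q := p) _.
    have := on (size p); rewrite size_rcons ltnSn => /(_ isT).
    by rewrite -cats1 take_size_cat.
  have kds : (k <= size ds)%N by rewrite -ltnS (leq_trans ki).
  move: kds; rewrite leq_eqVlt => /orP[/eqP kE|kds].
    by case: nq; rewrite pE kE take_size.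
  have dk : d = nth None ds k.
    by apply: contrapT => dk; apply: nq; rewrite pE; apply: Hoff.
  have qE : rcons p d = take k.+1 ds by rewrite pE dk -take_nth.
  have ik : i = k.+1.
    apply/eqP; rewrite eqn_leq ki andbT leqNgt; apply/negP => ki'.
    by case/negP: qP; rewrite qE; apply: mem_take_points; rewrite ki' ids.
  by rewrite ik.
split=> [i|q on]; last first.
  apply: contrapT => nq; have [] := key (size ds).+1 q (leqnn _) _ nq.
    by rewrite tk.
  by rewrite ltnn.
rewrite szP ltnS => ids; rewrite nth_points //; split.
  split; last exact: Hnot.
  split=> [|k].
    apply/negP => /(mem_points (leqW ids))[k ki] /(congr1 size).
    rewrite !size_takel ?(leq_trans (ltnW ki)) // => E.
    by rewrite E ltnn in ki.
  rewrite size_takel // => ki; rewrite take_takel ?(ltnW ki) //.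
  by apply: mem_take_points; rewrite ki leqW.
by move=> q [on nq]; have [_ ->] := key i q (leqW ids) on nq.
Qed.

End Resolution.

Section Admissible.
Variable n : nat.
Implicit Types eps : decoration n.

Definition admissible eps := [/\ ~~ straight_edge eps 1, straight_edge eps n.-1 &
  forall v, breaking_vertex eps v -> straight_edge eps v /\ straight_edge eps v.+1].

Lemma straight_edgeE eps (e : 'I_n.-1) : straight_edge eps e.+1 = (e \in eps.1).
Proof.
apply/existsP/idP => [[e' /andP[e'S /eqP[/val_inj <-]]]//|eS].
by exists e; rewrite eS eqxx.
Qed.

Lemma breaking_vertexE eps (v : 'I_n) : breaking_vertex eps v = (v \in eps.2).
Proof.
apply/existsP/idP => [[v' /andP[v'S /eqP/val_inj <-]]//|vS].
by exists v; rewrite vS eqxx.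
Qed.

Lemma straight_edgeP eps i : straight_edge eps i ->
  exists2 e : 'I_n.-1, e \in eps.1 & i = e.+1.
Proof. by case/existsP => e /andP[eS /eqP <-]; exists e. Qed.

Lemma breaking_vertexP eps i : breaking_vertex eps i ->
  exists2 v : 'I_n, v \in eps.2 & i = v.
Proof. by case/existsP => v /andP[vS /eqP <-]; exists v. Qed.

Lemma straight_edge_bound eps i : straight_edge eps i -> (0 < i < n)%N.
Proof. by case/straight_edgeP => e _ ->; rewrite /= -ltn_predRL ltn_ord. Qed.

End Admissible.

Section Diagrams.
Variables (R : realType) (n : nat).
Local Notation dir := (direction R).
Implicit Types (eps : decoration n) (ds : seq dir).

Lemma diagram_admissible eps ds : (1 < n)%N -> size (points ds) = n ->
  satellite ds (size ds) -> is_enriques_diagram (points ds) eps -> admissible eps.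
Proof.
move=> n1; rewrite size_mkseq => nE sat [D1 D2 D3].
have free i : (0 < i < n)%N -> straight_edge eps i <-> satellite ds i.
  move=> /andP[i0 iN]; have ids : (i <= size ds)%N by rewrite -ltnS nE.
  have := D1 i; rewrite i0 iN => /(_ isT); rewrite nth_points // is_free_take ?i0 // => H.
  split=> [s|s]; first by apply: contrapT => /(H.2); rewrite s.
  by apply: contraT => ns; case: (H.1 ns s).
split.
- by apply/negP => /(free 1%N n1)[].
- by apply/free; rewrite -nE //= ltnSn andbT; move: n1; rewrite -nE.
- move=> v /D3[i [k [-> [/andP[ik kn] L] s]]]; split=> //.
  have i2n : (i.+2 < n)%N by move: kn; rewrite size_mkseq nE; apply: leq_ltn_trans.
  have i2d : (i.+2 <= size ds)%N by rewrite -ltnS nE.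
  apply/free => //; exists i; first by [].
  have := L i.+2; rewrite size_mkseq ltnS i2d => /(_ isT).
  have id := ltnW (ltnW i2d); rewrite !nth_points ?proximate_takeE //.
  by move=> ->; rewrite ltnW.
Qed.

(** Direction j leads to the point of e_(j+1). A free point takes [Some 1], which is never a
    [follow] and so leaves all earlier exceptional curves. A straight edge after a straight edge and
    a neutral vertex repeats the direction, staying on the same curve; the other straight edges turn
    onto the curve just created. *)
Fixpoint direction_of eps j : dir :=
  if j is j'.+1 then
    if ~~ straight_edge eps j.+1 then Some 1
    else if straight_edge eps j && ~~ breaking_vertex eps j then direction_of eps j'
    else follow (direction_of eps j')
  else Some 1.

Definition directions eps : seq dir := mkseq (direction_of eps) n.-1.

Lemma satellite_directions eps j : admissible eps -> (0 < j < n)%N ->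
  satellite (directions eps) j <-> straight_edge eps j.
Proof.
move=> [s1 _ _]; have nthE i : (i.+1 < n)%N -> nth None (directions eps) i = direction_of eps i.
  by move=> iN; rewrite nth_mkseq //; case: (n) iN.
case: j => // j /=; elim: j => [|j IH] jn.
  by split=> [[i ij _]|s] //; rewrite s in s1.
have jn' := ltnW jn; have IHj := IH jn'.
split=> [[i ij /proxS[iE|[pi Ei]]]|s].
- by move: ij; rewrite iE ltnn.
- apply: contraT => ns; move: Ei; rewrite !nthE // /= ?ns /=; last first.
    exact: ltn_trans ij jn.
  by case: (direction_of eps i) => [c|] //= [/eqP]; rewrite oner_eq0.
have dE : direction_of eps j.+1 = if straight_edge eps j.+1 && ~~ breaking_vertex eps j.+1
    then direction_of eps j else follow (direction_of eps j) by rewrite /= s.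
case: ifP dE => [/andP[sj _]|_] dE.
  have [i ij pi] := IHj.2 sj; exists i; first by rewrite ltnW.
  apply/proxS; right; split=> //; rewrite !nthE //; last first.
    exact: ltn_trans ij jn'.
  have [_ H] := pi; have := H j; rewrite ltnSn andbT -ltnS ij => /(_ isT).
  by rewrite !nthE // ?dE //; apply: ltn_trans ij jn'.
exists j => //; apply/proxS; right; split; first exact: prox_self.
by rewrite !nthE.
Qed.

Lemma breaking_directions eps i : (i.+2 < n)%N -> straight_edge eps i.+1 ->
  straight_edge eps i.+2 -> prox (directions eps) i.+2 i <-> breaking_vertex eps i.+1.
Proof.
move=> i2 s1 s2; have nthE j : (j.+1 < n)%N -> nth None (directions eps) j = direction_of eps j.
  by move=> jN; rewrite nth_mkseq //; case: (n) jN.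
have i1 := ltnW i2.
have dE : direction_of eps i.+1 = if ~~ breaking_vertex eps i.+1
    then direction_of eps i else follow (direction_of eps i) by rewrite /= s1 s2.
rewrite proxS; split=> [[/eqP|[_]]|br].
- by rewrite -[_ == _]/(i == i.+1) ltn_eqF.
- rewrite !nthE // dE; case: (breaking_vertex _ _) => //= E.
  by case: (@follow_neq R (direction_of eps i)).
- right; split; first exact: prox_self.
  by rewrite !nthE // dE br.
Qed.

Lemma prox_max ds i j : (j <= size ds)%N -> prox ds j i -> exists k,
  [/\ (j <= k <= size ds)%N, prox ds k i & forall l, (k < l <= size ds)%N -> ~ prox ds l i].
Proof.
move=> jds pj; have exk : exists k, `[< (k <= size ds)%N /\ prox ds k i >].
  by exists j; apply/asboolP.
have bnd k : `[< (k <= size ds)%N /\ prox ds k i >] -> (k <= size ds)%N.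
  by move/asboolP => [].
case: (ex_maxnP exk bnd) => k /asboolP[kds pk] kmax; exists k; split=> //.
  by rewrite kds andbT; apply: kmax; apply/asboolP.
move=> l /andP[kl lds] pl; have : (l <= k)%N by apply: kmax; apply/asboolP.
by rewrite leqNgt kl.
Qed.

(** Proximity to a fixed point holds on an interval of indices ([prox_le]), so only its end
    matters. *)
Lemma long_proximityE ds i k : long_proximity (points ds) i k <->
  (i.+2 <= k <= size ds)%N /\ prox ds k i /\ (forall l, (k < l <= size ds)%N -> ~ prox ds l i).
Proof.
have szP : size (points ds) = (size ds).+1 by rewrite size_mkseq.
rewrite /long_proximity szP ltnS; split=> [[ik L]|[ik [pk kmax]]]; have /andP[i2k kd] := ik;
  have ids : (i <= size ds)%N by rewrite (leq_trans _ kd) // (leq_trans _ i2k) // leqW.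
  have E j : (j <= size ds)%N -> prox ds j i <-> (i < j <= k)%N.
    move=> jd; have := L j; rewrite ltnS jd => /(_ isT).
    by rewrite !nth_points // proximate_takeE.
  split=> //; split; first by apply/E => //; rewrite leqnn andbT (leq_trans _ i2k).
  by move=> l /andP[kl ld] /(E l ld)/andP[_]; rewrite leqNgt kl.
split=> // j; rewrite ltnS => jd; rewrite !nth_points // proximate_takeE //.
split=> [pj|ijk]; last exact: prox_le pk ijk.
rewrite pj.1 /= leqNgt; apply/negP => kj; apply: (kmax j) => //.
by rewrite kj jd.
Qed.

Lemma directions_diagram eps : (1 < n)%N -> admissible eps ->
  is_enriques_diagram (points (directions eps)) eps.
Proof.
move=> n1 ad; have [s1 _ sbr] := ad; set ds := directions eps.
have szd : (size ds).+1 = n by rewrite size_mkseq prednK // ltnW.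
have sat j : (0 < j <= size ds)%N -> satellite ds j <-> straight_edge eps j.
  by move=> /andP[j0 jd]; apply: satellite_directions => //; rewrite j0 -szd ltnS.
have br i : (i.+2 <= size ds)%N -> straight_edge eps i.+1 -> straight_edge eps i.+2 ->
    prox ds i.+2 i <-> breaking_vertex eps i.+1.
  by move=> id; apply: breaking_directions; rewrite -szd ltnS.
split.
- move=> i /andP[i0 iN]; have ids : (i <= size ds)%N by rewrite -ltnS szd.
  rewrite nth_points // is_free_take ?i0 // sat ?i0 //.
  by split=> /negP.
- move=> i k /long_proximityE[/andP[i2k kd] [pk kmax]].
  have st j : (i.+1 < j <= k)%N -> straight_edge eps j.
    move=> /andP[ij jk]; apply/sat; first by rewrite (leq_trans jk) // andbT (leq_trans _ ij).
    by exists i => //; apply: prox_le pk _; rewrite jk ltnW.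
  split; last first.
    move=> s; apply/(br i) => //; first exact: leq_trans kd.
      by apply: st; rewrite ltnSn.
    by apply: prox_le pk _; rewrite i2k andbT.
  (* A breaking vertex v_j strictly inside would make P_(j+1) proximate both to P_i and to P_(j-1),
     contrary to [prox_uniq]. *)
  have neutral j : (i.+1 < j < k)%N -> ~~ breaking_vertex eps j.
    case: j => // j /andP[ij jk]; apply/negP => bj; have [sj sj1] := sbr _ bj.
    have j2d : (j.+2 <= size ds)%N := leq_trans jk kd.
    have pj := (br j j2d sj sj1).2 bj.
    have pi : prox ds j.+2 i by apply: prox_le pk _; rewrite jk andbT !ltnS ltnW // ltnW.
    have ij' : i = j by apply: prox_uniq pi pj _ _ => //; rewrite !ltnS ltnW.
    by rewrite ij' ltnn in ij.
  split.
  + split=> //; first by rewrite i2k -szd ltnS.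
  (* An extension to the left needs e_(i+1) straight and v_(i+1) neutral, but then the proximity of
     P_(i+2) to P_i makes v_(i+1) breaking. *)
  + move=> a [ia] [_ sa na]; subst a.
    have s : straight_edge eps i.+1 by apply: sa; rewrite ltnSn ltnW.
    have : breaking_vertex eps i.+1.
      apply/(br i) => //; first exact: leq_trans kd.
        by apply: st; rewrite ltnSn.
      by apply: prox_le pk _; rewrite i2k andbT.
    by apply/negP/na; rewrite ltnSn i2k.
  (* An extension to the right makes P_(k+1) a satellite, proximate to some P_l. If l = k - 1, then
     v_k is breaking; otherwise l = i by [prox_uniq], contrary to the choice of k. *)
  + move=> [/andP[_ kn] sk nk].
    have k1d : (k.+1 <= size ds)%N by rewrite -ltnS szd.
    have [l lk pl] : satellite ds k.+1.
      by apply/sat => //; apply: sk; rewrite leqnn andbT ltnW // ltnS.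
    have pl' : prox ds k l by apply: prox_le pl _; rewrite leqnSn andbT -ltnS.
    case: k i2k kd pk kmax st neutral sk nk kn k1d lk pl pl' => // k i2k kd pk kmax st
      neutral sk nk kn k1d lk pl pl'.
    move: lk; rewrite !ltnS leq_eqVlt => /orP[/eqP lk|lk].
      subst l; have : breaking_vertex eps k.+1.
        apply/(br k) => //; first by apply: st; rewrite i2k leqnn.
        by apply: sk; rewrite leqnn andbT ltnS ltnW.
      by apply/negP/nk; rewrite i2k ltnSn.
    have il : l = i by apply: prox_uniq pl' pk _ _; rewrite ?ltnS.
    by apply: (kmax k.+2); rewrite ?ltnSn // -il.
- move=> j bj; have [sj sj1] := sbr _ bj.
  case: j bj sj sj1 => [|i] bj sj sj1; first by have := straight_edge_bound sj.
  have i2d : (i.+2 <= size ds)%N.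
    by have /andP[_] := straight_edge_bound sj1; rewrite -szd ltnS.
  have pi := (br i i2d sj sj1).2 bj.
  have [k [/andP[ik kd] pk kmax]] := prox_max i2d pi.
  exists i, k; split=> //; apply/long_proximityE; split; first by rewrite ik.
  by split.
Qed.

Lemma enriques_diagramP eps : (3 <= n)%N ->
  (exists (f : series R) (P : seq (point R)),
     [/\ plane_branch f, is_minimal_embedded_resolution f P, size P = n &
         is_enriques_diagram P eps]) <-> admissible eps.
Proof.
move=> n3; have n1 : (1 < n)%N by rewrite ltnW.
split=> [[f [P [/plane_branchP irf res szP D]]]|ad].
  have P0 : (0 < size P)%N by rewrite szP ltnW.
  have [ds PE [Hnot Hend]] := resolution_points P0 res.
  subst P; have ds0 : (0 < size ds)%N.
    by have := szP; rewrite size_mkseq => E; rewrite -ltnS E.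
  apply: (diagram_admissible n1 szP _ D); apply/axes_satellite.
  exact: last_point_satellite irf ds0 Hnot Hend.
pose ds := directions eps.
have szd : (size ds).+1 = n by rewrite size_mkseq prednK // ltnW.
have ax : axes ds = (true, true).
  apply/axes_satellite/satellite_directions => //.
    by rewrite -szd ltnSn andbT -ltnS szd.
  by have [_ s _] := ad; rewrite size_mkseq.
have [f [irf Hnot Hoff Hend]] := branch_exists ax.
exists f, (points ds); split; first exact/plane_branchP.
- exact: points_resolution.
- by rewrite size_mkseq.
- exact: directions_diagram.
Qed.

End Diagrams.

(** * The lattice *)

HB.instance Definition _ (R : realType) (n : nat) :=
  Choice.copy (enriques_diagrams R n) {eps : decoration n | _}.

Section Lattice.
Variables (R : realType) (n : nat) (n3 : (3 <= n)%N).
Local Notation diagram := (enriques_diagrams R n).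
Implicit Types (eps : decoration n) (x y z : diagram).

Lemma diagram_valP x : admissible (val x).
Proof. by apply/(enriques_diagramP R _ n3)/asboolP; apply: (valP x). Qed.

Definition diagram_of eps (ad : admissible eps) : diagram :=
  Sub eps (asboolT ((enriques_diagramP R eps n3).2 ad)).

Definition decoration_meet eps eps' : decoration n :=
  (eps.1 :&: eps'.1, eps.2 :&: eps'.2).
Definition decoration_join eps eps' : decoration n :=
  (eps.1 :|: eps'.1, eps.2 :|: eps'.2).

Lemma straight_edge_meet eps eps' i :
  straight_edge (decoration_meet eps eps') i = straight_edge eps i && straight_edge eps' i.
Proof.
apply/idP/andP => [/straight_edgeP[e /setIP[e1 e2] ->]|[/straight_edgeP[e es ->]]].
  by rewrite !straight_edgeE.
by rewrite !straight_edgeE inE es.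
Qed.

Lemma straight_edge_join eps eps' i :
  straight_edge (decoration_join eps eps') i = straight_edge eps i || straight_edge eps' i.
Proof.
apply/idP/orP => [/straight_edgeP[e /setUP es ->]|[]/straight_edgeP[e es ->]].
- by rewrite !straight_edgeE.
- by rewrite straight_edgeE inE es.
- by rewrite straight_edgeE inE es orbT.
Qed.

Lemma breaking_vertex_meet eps eps' i : breaking_vertex (decoration_meet eps eps') i ->
  breaking_vertex eps i /\ breaking_vertex eps' i.
Proof. by case/breaking_vertexP => v /setIP[v1 v2] ->; rewrite !breaking_vertexE. Qed.

Lemma breaking_vertex_join eps eps' i : breaking_vertex (decoration_join eps eps') i ->
  breaking_vertex eps i \/ breaking_vertex eps' i.
Proof. by case/breaking_vertexP => v /setUP vs ->; rewrite !breaking_vertexE. Qed.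

Lemma admissible_meet eps eps' : admissible eps -> admissible eps' ->
  admissible (decoration_meet eps eps').
Proof.
move=> [a1 a2 a3] [b1 b2 b3]; split; rewrite ?straight_edge_meet ?a2 ?b2 ?(negPf a1) //.
move=> v /breaking_vertex_meet[/a3[s1 s2] /b3[t1 t2]].
by rewrite !straight_edge_meet s1 s2 t1 t2.
Qed.

Lemma admissible_join eps eps' : admissible eps -> admissible eps' ->
  admissible (decoration_join eps eps').
Proof.
move=> [a1 a2 a3] [b1 b2 b3].
split; rewrite ?straight_edge_join ?a2 // ?(negPf a1) ?(negPf b1) //.
by move=> v /breaking_vertex_join[/a3|/b3] [s1 s2]; rewrite !straight_edge_join s1 s2 ?orbT.
Qed.

(** The symbols omitted from [code] are the same for all admissible decorations: e_1 is curved,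
    e_(n-1) is straight, and v_0, v_1, v_(n-1) each lack a straight edge on one side, so they cannot
    be breaking. *)
Lemma code_subset eps eps' : admissible eps -> admissible eps' ->
  (code eps \subset code eps') = (eps.1 \subset eps'.1) && (eps.2 \subset eps'.2).
Proof.
move=> [a1 a2 a3] [b1 b2 b3].
apply/subsetP/andP => [H|[/subsetP H1 /subsetP H2]]; last first.
  by case=> [e|v]; rewrite !inE => /andP[->]; [move/H1|move/H2].
split; apply/subsetP; [move=> e es|move=> v vs].
  have [en|en] := eqVneq e.+1 n.-1.
    by rewrite -straight_edgeE en.
  have e1 : e.+1 != 1%N.
    by apply: contra a1 => /eqP e1; rewrite -e1 straight_edgeE.
  have rng : (1 < e.+1 <= n - 2)%N by have := ltn_ord e; lia.
  by have := H (inl e); rewrite !inE rng es => /(_ isT).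
have [s1 s2] : straight_edge eps v /\ straight_edge eps v.+1.
  by apply: a3; rewrite breaking_vertexE.
have v1 : (nat_of_ord v) != 1%N by apply: contra a1 => /eqP <-.
have rng : (1 < v <= n - 2)%N.
  by have := straight_edge_bound s1; have := straight_edge_bound s2; lia.
by have := H (inr v); rewrite !inE rng vs => /(_ isT).
Qed.

Lemma staircaseE x y :
  staircase x y = ((val x).1 \subset (val y).1) && ((val x).2 \subset (val y).2).
Proof. by apply: code_subset; apply: diagram_valP. Qed.

Definition diagram_meet x y : diagram :=
  diagram_of (admissible_meet (diagram_valP x) (diagram_valP y)).
Definition diagram_join x y : diagram :=
  diagram_of (admissible_join (diagram_valP x) (diagram_valP y)).

Lemma diagram_eqP x y : (val x).1 = (val y).1 -> (val x).2 = (val y).2 -> x = y.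
Proof. by move=> E1 E2; apply: val_inj; rewrite [LHS]surjective_pairing E1 E2 -surjective_pairing. Qed.

Lemma staircase_meet x y : staircase x y = (diagram_meet x y == x).
Proof.
rewrite staircaseE -val_eqE /= -pair_eqE /=.
by rewrite /pair_eq /=; congr (_ && _); apply/setIidPl/eqP.
Qed.

Lemma diagram_meetC : commutative diagram_meet.
Proof. by move=> x y; apply: diagram_eqP; apply: setIC. Qed.
Lemma diagram_joinC : commutative diagram_join.
Proof. by move=> x y; apply: diagram_eqP; apply: setUC. Qed.
Lemma diagram_meetA : associative diagram_meet.
Proof. by move=> x y z; apply: diagram_eqP; apply: setIA. Qed.
Lemma diagram_joinA : associative diagram_join.
Proof. by move=> x y z; apply: diagram_eqP; apply: setUA. Qed.
Lemma diagram_joinKI y x : diagram_meet x (diagram_join x y) = x.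
Proof. by apply: diagram_eqP; rewrite /= setUC setKU. Qed.
Lemma diagram_meetKU y x : diagram_join x (diagram_meet x y) = x.
Proof. by apply: diagram_eqP; rewrite /= setIC setKI. Qed.
Lemma diagram_meetUl : left_distributive diagram_meet diagram_join.
Proof. by move=> x y z; apply: diagram_eqP; apply: setIUl. Qed.
Lemma diagram_meetxx : idempotent_op diagram_meet.
Proof. by move=> x; apply: diagram_eqP; apply: setIid. Qed.

End Lattice.

Theorem proposition8p2 (R : realType) (n : nat) (hn : (3 <= n)%N) :
  exists (d : Order.disp_t)
         (L : Order.DistrLattice d (enriques_diagrams R n)),
    forall x y : enriques_diagrams R n,
      @Order.le d (Order.DistrLattice.Pack L) x y = staircase x y.
Proof.
(* The relation [staircase] is itself supplied as the order, so the final equality holds by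
   computation. *)
pose m := @Order.isMeetJoinDistrLattice.Build (Order.Disp tt tt) (enriques_diagrams R n)
  (@staircase R n) (fun x y => (y != x) && staircase x y)
  (diagram_meet hn) (diagram_join hn) (staircase_meet hn) (fun x y => erefl)
  (@diagram_meetC R n hn) (@diagram_joinC R n hn) (@diagram_meetA R n hn)
  (@diagram_joinA R n hn) (@diagram_joinKI R n hn) (@diagram_meetKU R n hn)
  (@diagram_meetUl R n hn) (@diagram_meetxx R n hn).
pose L : distrLatticeType (Order.Disp tt tt) := HB.pack (enriques_diagrams R n) m.
by exists (Order.Disp tt tt), (Order.DistrLattice.class L).
Qed.
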